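(* The formula $$d_{\Pi}^{\mathcal M}(\mathcal P,\mathcal Q)=\sum_{N=1}^{\infty}\frac{1}{N\cdot2^N}\,(d_{\mathrm P})_H\bigl(\mathcal M(\mathcal P;N,N),\mathcal M(\mathcal Q;N,N)\bigr)$$ defines a metric on the set of all pyramids of qm-spaces. For pyramids $\mathcal P_n$ ($n=1,2,\dots$) and $\mathcal P$ of qm-spaces, the following are equivalent. (i) $\mathcal P_n$ converges weakly to $\mathcal P$. (ii) For every positive integer $N$ and every real number $R>0$, $(d_{\mathrm P})_H(\mathcal M(\mathcal P_n;N,R),\mathcal M(\mathcal P;N,R))\to0$. (iii) $d_{\Pi}^{\mathcal M}(\mathcal P_n,\mathcal P)\to0$.
   Context: A qm-space is a triple $(X,d_X,\mu_X)$ (written $X$) such that: $d_X\colon X\times X\to[0,+\infty)$ satisfies $d_X(x,x)=0$ and the triangle inequality; $d_X^{\mathrm s}(x,y)=\max\{d_X(x,y),d_X(y,x)\}$ is a complete separable metric on $X$; and $\mu_X$ is a Borel probability measure on $(X,d_X^{\mathrm s})$ with full support. Two qm-spaces $X,Y$ are isomorphic if there is a bijection $\varphi\colon X\to Y$ preserving $d$ and the measures. $\mathcal X^{+}$ is the set of isomorphism classes. Write $Y\preceq X$ if there is a map $u\colon X\to Y$ with $u_*\mu_X=\mu_Y$ and $d_Y(u(x),u(x'))\leq d_X(x,x')$ for all $x,x'$. For a qm-space $X$, $\operatorname{Lip}^{+}_1(X)=\{f\colon X\to\mathbb R\mid f(y)-f(x)\leq d_X(x,y)\ \text{for all }x,y\in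 X\}$. $\mathcal T(\mu,\nu)$ is the set of couplings; $\operatorname{pr}_i$ are the projections; $F\circ\operatorname{pr}_i=\{f\circ\operatorname{pr}_i\mid f\in F\}$; $(d)_H$ is the Hausdorff (pseudo)distance induced by $d$. For closed $S\subset X\times Y$, $d^S_\infty(h,k)=\sup_{S}|h-k|$, and $(d^S_\infty)_H$ is set to $0$ if $S=\emptyset$. The box distance is $$\Box(X,Y)=\inf\max\{1-\pi(S),\,2(d^S_\infty)_H(\operatorname{Lip}^{+}_1(X)\circ\operatorname{pr}_1,\operatorname{Lip}^{+}_1(Y)\circ\operatorname{pr}_2)\}$$ over $\pi\in\mathcal T(\mu_X,\mu_Y)$ and closed $S\subset X\times Y$; it is a metric on $\mathcal X^{+}$. For a set $\mathcal E$, $\Box(A,\mathcal E)=\inf_{B\in\mathcal E}\Box(A,B)$. A pyramid of qm-spaces is a nonempty, $\preceq$-downward closed, $\Box$-closed subset of $\mathcal X^{+}$ in which any two elements have a common upper bound (for $\preceq$). Pyramids $\mathcal P_n$ converge weakly to a pyramid $\mathcal P$ if $\Box(A,\mathcal P_n)\to0$ for every $A\in\mathcal P$ and $\liminf_n\Box(A,\mathcal P_n)>0$ for every $A\in\mathcal X^{+}\setminus\mathcal P$. For a positive integer $N$ and $R>0$, let $d_{\mathrm P}$ be the Prokhorov distance on Borel probability measures on $[-R,R]^N$ induced by the $\ell^\infty$ distance, and $b_R(t)=\max\{-R,\min\{t,R\}\}$. Set $$\mathcal M(X;N,R)=\{(b_R\circ f_1,\dots,b_R\circ f_N)_*\mu_X\mid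 f_1,\dots,f_N\in\operatorname{Lip}^{+}_1(X)\},\qquad \mathcal M(\mathcal P;N,R)=\bigcup_{X\in\mathcal P}\mathcal M(X;N,R).$$ *)

(* Defs.v *)
From HB Require Import structures.
From mathcomp Require Import all_boot all_order all_algebra.
From mathcomp Require Import all_classical all_reals all_analysis.

Set Implicit Arguments.
Unset Strict Implicit.
Unset Printing Implicit Defensive.

Import Order.TTheory GRing.Theory Num.Theory.
Import numFieldNormedType.Exports.

Local Open Scope classical_set_scope.
Local Open Scope ring_scope.
Local Open Scope ereal_scope.

#[short(type="completeMetricType")]
HB.structure Definition CompleteMetric (R : numDomainType) :=
  {T of Metric R T & Complete T}.

Notation borel T := (g_sigma_algebraType (@open T)).

Definition is_pushforward (d d' : measure_display) (T : measurableType d)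
    (T' : measurableType d') (R : realType) (u : T -> T')
    (mu : probability T R) (nu : probability T' R) : Prop :=
  forall B : set T', measurable B -> pushforward mu u B = nu B.

(** The metric [mdist] of the carrier is the symmetrization of [qdist].  The
    distinguished point of the carrier comes from the library hierarchy; it
    exists in every case, as there is a probability measure, and it is ignored
    by all the notions below. *)
Record qmspace (R : realType) := QMSpace {
  carrier :> completeMetricType R ;
  qdist : carrier -> carrier -> R ;
  qdist_ge0 : forall x y, (0 <= qdist x y)%R ;
  qdistxx : forall x, qdist x x = 0%R ;
  qdist_triangle : forall x y z, (qdist x z <= qdist x y + qdist y z)%R ;
  mdistE : forall x y : carrier,
    mdist x y = Num.max (qdist x y) (qdist y x) ;
  qm_separable : exists2 D : set carrier, countable D & dense D ;
  qmeasure : probability (borel carrier) R ;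
  qmeasure_full_support :
    forall U : set carrier, open U -> U !=set0 -> 0 < qmeasure U }.

Arguments qdist {R q}.
Arguments qmeasure {R} q.

Section qmspaces.
Variable R : realType.
Implicit Types X Y : qmspace R.

Definition isomorphic X Y : Prop :=
  exists phi : X -> Y,
    [/\ bijective phi,
        forall x x', qdist (phi x) (phi x') = qdist x x'
      & is_pushforward (phi : borel X -> borel Y) (qmeasure X) (qmeasure Y)].

(** [dominated Y X] is Y <= X in the Lipschitz order.  Such a [u] is
    continuous for the symmetrized metrics, hence Borel measurable. *)
Definition dominated Y X : Prop :=
  exists u : X -> Y,
    is_pushforward (u : borel X -> borel Y) (qmeasure X) (qmeasure Y) /\
    forall x x', (qdist (u x) (u x') <= qdist x x')%R.

Definition Lip1 X : set (X -> R) :=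
  [set f | forall x y, (f y - f x <= qdist x y)%R].

(** On nonempty sets this is the usual Hausdorff distance; on empty sets it
    depends on the convention [ereal_sup set0 = -oo], and is not used there. *)
Definition hausdorff (T : Type) (d : T -> T -> \bar R) (A B : set T) : \bar R :=
  maxe (ereal_sup [set ereal_inf [set d a b | b in B] | a in A])
       (ereal_sup [set ereal_inf [set d a b | a in A] | b in B]).

Definition sup_dist (T : Type) (S : set T) (h k : T -> R) : \bar R :=
  ereal_sup [set `|h z - k z|%:E | z in S].

Definition sup_hausdorff (T : Type) (S : set T) (F G : set (T -> R)) : \bar R :=
  if `[< S = set0 >] then 0 else hausdorff (sup_dist S) F G.

Definition coupling X Y (pi : probability (borel (X * Y)%type) R) : Prop :=
  is_pushforward (fst : borel (X * Y)%type -> borel X) pi (qmeasure X) /\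
  is_pushforward (snd : borel (X * Y)%type -> borel Y) pi (qmeasure Y).

Definition box X Y : \bar R :=
  ereal_inf [set r | exists (pi : probability (borel (X * Y)%type) R)
                            (S : set (X * Y)),
    [/\ coupling pi, closed S &
        r = maxe (1 - pi S)
                 (2%:E * sup_hausdorff S [set f \o fst | f in @Lip1 X]
                                         [set g \o snd | g in @Lip1 Y])]].

End qmspaces.

(** Plain predicates are used instead of [set (qmspace R)], and below instead
    of [set (isoclass R)]: [qmspace R] lives in a universe above those of the
    library structures. *)
Record isoclass (R : realType) := IsoClass {
  members : qmspace R -> Prop ;
  membersP : exists X, members = isomorphic X }.

Definition representative (R : realType) (A : isoclass R) : qmspace R :=
  sval (cid (membersP A)).

(** Through this coercion [dominated], [box] and the measurements below apply
    to isomorphism classes; they are invariant under isomorphism. *)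
Coercion representative : isoclass >-> qmspace.

Definition box_to (R : realType) (A : isoclass R) (E : isoclass R -> Prop) :
    \bar R :=
  ereal_inf [set r | exists B : isoclass R, E B /\ r = box A B].

Record pyramid (R : realType) := Pyramid {
  in_pyramid :> isoclass R -> Prop ;
  pyramid_nonempty : exists A, in_pyramid A ;
  pyramid_downward : forall A B : isoclass R,
    in_pyramid A -> dominated B A -> in_pyramid B ;
  pyramid_closed : forall A : isoclass R,
    (forall e : R, (0 < e)%R -> exists B, in_pyramid B /\ box A B < e%:E) ->
    in_pyramid A ;
  pyramid_directed : forall A B : isoclass R,
    in_pyramid A -> in_pyramid B ->
    exists C, [/\ in_pyramid C, dominated A C & dominated B C] }.

Definition weakly_converges (R : realType) (Ps : nat -> pyramid R)
    (P : pyramid R) : Prop :=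
  (forall A : isoclass R, P A -> box_to A (Ps n) @[n --> \oo] --> 0) /\
  (forall A : isoclass R, ~ P A -> 0 < limn_einf (fun n => box_to A (Ps n))).

Section measurements.
Variable R : realType.

Definition cube_set (N : nat) (r : {posnum R}) : set 'rV[R]_N :=
  [set x | forall i, (- r%:num <= x ord0 i <= r%:num)%R].

Arguments cube_set : clear implicits.

(** [-r, r]^N, as a type, with the topology induced by that of R^N. *)
Definition cube (N : nat) (r : {posnum R}) : Type := set_type (cube_set N r).

Lemma cube_set0 (N : nat) (r : {posnum R}) : 0%R \in cube_set N r.
Proof. by apply/mem_set => i; rewrite mxE oppr_le0 !ge0. Qed.

HB.instance Definition _ N r := Topological.on (cube N r).
HB.instance Definition _ N r :=
  isPointed.Build (cube N r) (exist _ 0%R (cube_set0 N r)).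

Definition linfty_dist N r (x y : cube N r) : R :=
  \big[Num.max/0%R]_(i < N) `|val x ord0 i - val y ord0 i|%R.

Definition prokhorov N r (mu nu : probability (borel (cube N r)) R) : \bar R :=
  ereal_inf [set e%:E | e in [set e : R | (0 < e)%R /\
    forall A : set (borel (cube N r)), measurable A ->
      let Ae := [set x | exists2 a, A a & (linfty_dist x a < e)%R] in
      mu A <= nu Ae + e%:E /\ nu A <= mu Ae + e%:E]].

Definition truncate (r : {posnum R}) (t : R) : R :=
  Num.max (- r%:num)%R (Num.min t r%:num).

Lemma truncate_cube (N : nat) (r : {posnum R}) (t : 'I_N -> R) :
  (\row_i truncate r (t i))%R \in cube_set N r.
Proof.
apply/mem_set => i; rewrite mxE /truncate le_max lexx/= ge_max ge_min lexx orbT.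
by rewrite andbT ge0_cp.
Qed.

Definition truncated_map (N : nat) (r : {posnum R}) (X : qmspace R)
    (f : 'I_N -> X -> R) (x : X) : cube N r :=
  exist (fun v => v \in cube_set N r) _ (truncate_cube r (fun i => f i x)).

Definition measurement (X : qmspace R) (N : nat) (r : {posnum R}) :
    set (probability (borel (cube N r)) R) :=
  [set nu | exists f : 'I_N -> X -> R,
    (forall i, Lip1 (f i)) /\
    is_pushforward (truncated_map r f : borel X -> borel (cube N r))
      (qmeasure X) nu].

Definition pyramid_measurement (P : pyramid R) (N : nat) (r : {posnum R}) :
    set (probability (borel (cube N r)) R) :=
  [set nu | exists X : isoclass R, P X /\ @measurement X N r nu].

Definition posnat (n : nat) : {posnum R} := PosNum (ltr0Sn R n).

(** The sum over N >= 1, with N = n.+1. *)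
Definition dPi (P Q : pyramid R) : \bar R :=
  \sum_(n <oo) ((n.+1%:R * 2 ^+ n.+1)^-1)%:E *
    hausdorff (@prokhorov n.+1 (posnat n))
      (@pyramid_measurement P n.+1 (posnat n))
      (@pyramid_measurement Q n.+1 (posnat n)).

End measurements.

Arguments pyramid_measurement {R} P N r.

Definition is_metric (R : realType) (T : Type) (d : T -> T -> \bar R) : Prop :=
  [/\ forall x y, 0 <= d x y /\ d x y \is a fin_num,
      forall x y, d x y = 0 <-> x = y,
      forall x y, d x y = d y x
    & forall x y z, d x z <= d x y + d y z].

(* Main.v *)
Require Import Defs.
From HB Require Import structures.
From mathcomp Require Import all_boot all_order all_algebra.
From mathcomp Require Import all_classical all_reals all_analysis.
From mathcomp Require Import lra.

Set Implicit Arguments.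
Unset Strict Implicit.
Unset Printing Implicit Defensive.

Import Order.TTheory GRing.Theory Num.Theory.
Import numFieldNormedType.Exports.

Local Open Scope classical_set_scope.
Local Open Scope ring_scope.
Local Open Scope ereal_scope.

(** A measure [nu] on the cube [-r, r]^N carries a qm-space, its support space:
    the support of [nu] with [nu] itself and the quasi-metric
    q(x, y) = max_i (y_i - x_i)^+, the smallest one for which the coordinates
    are in Lip1.  If [nu] is the law of a truncated N-tuple of Lip1 functions
    on X, that tuple is a domination of the support space by X; conversely the
    coordinates of the support space have law [nu].  So [nu] is a measurement of a pyramid P if and only if P
    contains its support space ([pyramid_measurement_support]), and the theorem
    is a comparison of the box distance with the Prokhorov distance.  It rests
    on three facts.

    First, measurements are stable under the box distance ([measurement_box]):
    an almost optimal pair of a coupling and a closed set S transports N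
    functions of Lip1 X to N functions of Lip1 Y that are uniformly close to
    them on S, so the two laws are Prokhorov close.

    Second, X is approximated by finitely many of its Lip1 functions
    ([measurement_approx]).  With a dense sequence x_0, x_1, ... the functions
    d(x_0, .), ..., d(x_m, .) recover d up to a small error on a set of measure
    almost 1.  If a measure is Prokhorov close to their joint law, its support
    space is box close to X.  The coupling that this requires is found as
    follows.  A fine grid, slightly shifted on the second cube, cuts both
    spaces into finitely many pieces with almost the same masses, and two such
    partitions are matched by a coupling up to a small loss of mass
    ([finite_coupling]).  Matched points have almost the same distances, and
    then McShane extension transports Lip1 functions in both directions
    ([box_le]).

    Third, the Prokhorov distance on the cube is compact
    ([ultra_prokhorov_limit]): along an ultrafilter the masses of nested cells
    converge to a consistent system of weights on the binary tree, and such a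
    system is the law of a map from the unit interval that follows the branch
    prescribed by the weights.

    If the measurements of P and Q are at distance 0, the second fact puts every
    element of P in the box closure of Q, so P = Q; the same argument gives
    weak convergence from convergence of measurements.  Conversely, suppose
    P_n converges weakly to P but measurements do not converge.  Take bad
    measurements along an ultrafilter and let [nu] be their limit.  If they
    come from P, the first fact, applied to one of them that is close to
    [nu], contradicts their badness.  If they come from P_n, their support
    spaces are in P_n and box converge to the support space of [nu], which is
    therefore in P, and [nu] contradicts their badness.  Finally the
    measurements of a small cube are 1-Lipschitz images of those of a larger
    one, so each Hausdorff distance is controlled by a term of the series
    [dPi], whose weights are summable. *)

(** * Limits of nonnegative sequences and Hausdorff distances *)

Lemma cvge0P (R : realType) (u : nat -> \bar R) : (forall n, 0 <= u n) ->
  u @ \oo --> 0 <-> forall e : R, (0 < e)%R -> \forall n \near \oo, u n < e%:E.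
Proof.
move=> u0; split=> [H e e0|H].
  by apply: (H [set x | x < e%:E]); apply: open_ereal_lt'; rewrite lte_fin.
move=> U HU; have : nbhs (0%R : R) (fun t : R => U t%:E) by exact: HU.
move=> /nbhs_ballP[e /= e0 eU].
have := H _ e0; apply: filterS => n; have := u0 n; rewrite /preimage /=.
case: (u n) => [t|//|//] /=; rewrite lee_fin lte_fin => t0 te.
by apply: eU; rewrite /ball/= sub0r normrN ger0_norm.
Qed.

Lemma limn_einf_gt0P (R : realType) (u : nat -> \bar R) : 0 < limn_einf u <->
  exists2 e : R, (0 < e)%R & \forall n \near \oo, e%:E <= u n.
Proof.
rewrite limn_einf_lim (cvg_lim _ (@cvg_einfs_sup R u))//; split.
  move=> /ereal_sup_gt[_ [n _ <-]] un.
  have [e e0 en] : exists2 e : R, (0 < e)%R & e%:E <= einfs u n.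
    case E : (einfs u n) un => [l| |] // l0; last by exists 1%R; rewrite ?leey.
    by exists l; rewrite ?lexx// -lte_fin.
  exists e => //; exists n => // k /= nk; apply: (le_trans en).
  by apply: ereal_inf_lbound; exists k.
move=> [e e0 [n _ nP]]; apply: (@lt_le_trans _ _ e%:E); first by rewrite lte_fin.
apply: (@le_trans _ _ (einfs u n)).
  by apply: le_ereal_inf_tmp => _ [k /= nk <-]; exact: nP.
by apply: ereal_sup_ubound; exists n.
Qed.

Section hausdorff_lemmas.
Context (R : realType) (T : Type) (d : T -> T -> \bar R).
Implicit Types (A B C : set T) (e : \bar R).

Lemma hausdorff_lt A B e : hausdorff d A B < e ->
  (forall a, A a -> exists2 b, B b & d a b < e) /\
  (forall b, B b -> exists2 a, A a & d a b < e).
Proof.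
rewrite /hausdorff gt_max => /andP[AB BA]; split => [a Aa|b Bb].
  have /ereal_inf_lt[_ [b Bb <-] dabe] : ereal_inf [set d a b | b in B] < e.
    by apply: le_lt_trans AB; apply: ereal_sup_ubound; exists a.
  by exists b.
have /ereal_inf_lt[_ [a Aa <-] dabe] : ereal_inf [set d a b | a in A] < e.
  by apply: le_lt_trans BA; apply: ereal_sup_ubound; exists b.
by exists a.
Qed.

Lemma hausdorff_le A B e :
  (forall a, A a -> exists2 b, B b & d a b <= e) ->
  (forall b, B b -> exists2 a, A a & d a b <= e) -> hausdorff d A B <= e.
Proof.
move=> AB BA; rewrite /hausdorff ge_max; apply/andP; split;
  apply: ge_ereal_sup => _ [x Xx <-].
  have [b Bb dle] := AB _ Xx.
  by apply: le_trans dle; apply: ereal_inf_lbound; exists b.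
have [a Aa dle] := BA _ Xx.
by apply: le_trans dle; apply: ereal_inf_lbound; exists a.
Qed.

Lemma hausdorff_ge0 A B : (forall x y, 0 <= d x y) -> A !=set0 ->
  0 <= hausdorff d A B.
Proof.
move=> d0 [a Aa]; rewrite /hausdorff le_max; apply/orP; left.
apply: (@le_trans _ _ (ereal_inf [set d a b | b in B])).
  by apply: le_ereal_inf_tmp => _ [b _ <-].
by apply: ereal_sup_ubound; exists a.
Qed.

Lemma hausdorffxx A : (forall x y, 0 <= d x y) -> (forall x, d x x = 0) ->
  A !=set0 -> hausdorff d A A = 0.
Proof.
move=> d0 dxx A0; apply/eqP; rewrite eq_le hausdorff_ge0// andbT.
by apply: hausdorff_le => x Ax; exists x => //; rewrite dxx.
Qed.

Lemma hausdorff_sym A B : (forall x y, d x y = d y x) ->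
  hausdorff d A B = hausdorff d B A.
Proof.
move=> dC; rewrite /hausdorff maxC; congr maxe; congr ereal_sup.
  by apply: eq_imagel => x _; congr ereal_inf; apply: eq_imagel => y _.
by apply: eq_imagel => x _; congr ereal_inf; apply: eq_imagel => y _.
Qed.

Lemma hausdorff_triangle A B C : (forall x y, 0 <= d x y) ->
  (forall x y z, d x z <= d x y + d y z) -> A !=set0 -> B !=set0 ->
  hausdorff d A C <= hausdorff d A B + hausdorff d B C.
Proof.
move=> d0 dtri A0 B0.
have [->|ABy] := eqVneq (hausdorff d A B) +oo.
  by rewrite addye ?leey// -ltNye (lt_le_trans _ (hausdorff_ge0 C d0 B0)).
have [->|BCy] := eqVneq (hausdorff d B C) +oo.
  by rewrite addey ?leey// -ltNye (lt_le_trans _ (hausdorff_ge0 B d0 A0)).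
have ABf : hausdorff d A B \is a fin_num by rewrite ge0_fin_numE ?ltey// hausdorff_ge0.
have BCf : hausdorff d B C \is a fin_num by rewrite ge0_fin_numE ?ltey// hausdorff_ge0.
apply/lee_addgt0Pr => e e0.
have e20 : (0 < e / 2)%R by rewrite divr_gt0.
have /hausdorff_lt[AB BA] : hausdorff d A B < hausdorff d A B + (e / 2)%:E.
  by rewrite lteDl.
have /hausdorff_lt[BC CB] : hausdorff d B C < hausdorff d B C + (e / 2)%:E.
  by rewrite lteDl.
have -> : hausdorff d A B + hausdorff d B C + e%:E =
    (hausdorff d A B + (e / 2)%:E) + (hausdorff d B C + (e / 2)%:E).
  by rewrite addeACA -EFinD -splitr.
apply: hausdorff_le => [a /AB[b /BC[c Cc bc] ab]|c /CB[b /BA[a Aa ab] bc]].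
  by exists c => //; apply: le_trans (dtri _ b _) _; apply: leeD; exact: ltW.
by exists a => //; apply: le_trans (dtri _ b _) _; apply: leeD; exact: ltW.
Qed.

End hausdorff_lemmas.

(** * The cube with the uniform distance *)

Section cube_lemmas.
Context (R : realType) (N : nat) (r : {posnum R}).
Implicit Types (x y z : cube N r) (e : R).

Lemma cube_le x i : (- r%:num <= val x ord0 i <= r%:num)%R.
Proof. by case: x => x /= /set_mem/(_ i). Qed.

Lemma linfty_ltP x y e : (0 < e)%R ->
  (linfty_dist x y < e)%R <-> forall i, (`|val x ord0 i - val y ord0 i| < e)%R.
Proof.
move=> e0; split=> [/bigmax_ltP[_ H] i|H]; first exact: H.
by apply/bigmax_ltP; split.
Qed.

Lemma linfty_leP x y e : (0 <= e)%R ->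
  (linfty_dist x y <= e)%R <-> forall i, (`|val x ord0 i - val y ord0 i| <= e)%R.
Proof.
move=> e0; split=> [/bigmax_leP[_ H] i|H]; first exact: H.
by apply/bigmax_leP; split.
Qed.

Lemma linfty_ge0 x y : (0 <= linfty_dist x y)%R.
Proof. by rewrite /linfty_dist; apply: bigmax_ge_id. Qed.

Lemma le_linfty x y i : (`|val x ord0 i - val y ord0 i| <= linfty_dist x y)%R.
Proof. exact: le_bigmax. Qed.

Lemma linftyxx x : linfty_dist x x = 0%R.
Proof.
apply/eqP; rewrite eq_le linfty_ge0 andbT; apply/linfty_leP => // i.
by rewrite subrr normr0.
Qed.

Lemma linftyC x y : linfty_dist x y = linfty_dist y x.
Proof. by apply: eq_bigr => i _; rewrite distrC. Qed.

Lemma linfty_triangle y x z :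
  (linfty_dist x z <= linfty_dist x y + linfty_dist y z)%R.
Proof.
apply/linfty_leP => [|i]; first by rewrite addr_ge0 ?linfty_ge0.
apply: le_trans (ler_distD (val y ord0 i) _ _) _.
by apply: lerD; exact: le_linfty.
Qed.

Lemma linfty_eq0 x y : linfty_dist x y = 0%R -> x = y.
Proof.
move=> xy; apply/val_inj/rowP => i; apply/eqP; rewrite -subr_eq0 -normr_eq0.
by rewrite -normr_le0 normr_id -xy le_linfty.
Qed.

Lemma val_continuous_cube : continuous (fun x : cube N r => val x : 'rV[R]_N).
Proof.
have := @initial_continuous _ _ (set_val : cube N r -> 'rV[R]_N).
by rewrite set_valE; exact.
Qed.

Lemma coord_continuous_cube i : continuous (fun x : cube N r => val x ord0 i : R).
Proof.
move=> x; apply: (@continuous_comp (cube N r) 'rV[R]_N R (fun x => val x)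
  (fun v => v ord0 i)); last exact: coord_continuous.
exact: val_continuous_cube.
Qed.

(** Together with the next lemma: the topology induced by R^N is the one of
    [linfty_dist]. *)
Lemma open_linfty_ball x e : open [set y | (linfty_dist y x < e)%R].
Proof.
have [e0|e0] := ltP 0%R e; last first.
  rewrite (_ : mkset _ = set0); first exact: open0.
  apply/seteqP; split => y //= /lt_le_trans/(_ e0).
  by rewrite ltNge linfty_ge0.
rewrite openE => y /= /linfty_ltP => /(_ e0) xy; rewrite /interior.
near=> z; apply/linfty_ltP => //; near: z.
apply: filter_forall => i.
have d0 : (0 < e - `|val y ord0 i - val x ord0 i|)%R by rewrite subr_gt0 xy.
have /cvgrPdist_lt/(_ _ d0) := @coord_continuous_cube i y.
apply: filterS => z yz; apply: le_lt_trans (ler_distD (val y ord0 i) _ _) _.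
by rewrite distrC -ltrBrDr.
Unshelve. all: by end_near. Qed.

Lemma nbhs_linfty x (U : set (cube N r)) : nbhs x U ->
  exists2 e : R, (0 < e)%R & [set y | (linfty_dist y x < e)%R] `<=` U.
Proof.
case=> B [[V oV VB] Bx BU].
have Vx : V (val x) by move: Bx; rewrite -VB set_valE.
have : nbhs (val x) V by apply: open_nbhs_nbhs.
move=> /nbhs_ballP[e /= e0 eV]; exists e => // y /linfty_ltP => /(_ e0) xy.
apply: BU; rewrite -VB set_valE /=; apply: eV; split => // i j.
by rewrite (ord1 i) /ball/= distrC; exact: xy.
Qed.

End cube_lemmas.

(** * Borel sets, image measures and the Prokhorov distance *)

(** Makes the product topology and the product base point one structure, as
    the general lemmas on Borel sets of [ptopologicalType] require for
    products of qm-spaces. *)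
HB.instance Definition _ (S T : ptopologicalType) := Pointed.on (S * T)%type.

Lemma open_borel (T : ptopologicalType) (U : set T) :
  open U -> measurable (U : set (borel T)).
Proof. by move=> oU; exact: sub_sigma_algebra. Qed.

Lemma closed_borel (T : ptopologicalType) (F : set T) :
  closed F -> measurable (F : set (borel T)).
Proof.
move=> cF; rewrite -(setCK F); apply: measurableC.
by apply: open_borel; exact: closed_openC.
Qed.

Lemma measurable_to_borel d (S : measurableType d) (T : ptopologicalType)
    (f : S -> T) : (forall U : set T, open U -> measurable (f @^-1` U)) ->
  measurable_fun setT (f : S -> borel T).
Proof.
move=> fo; apply: (@measurability _ _ _ (borel T) setT f (@open T)) => //.
by move=> _ [U oU <-]; rewrite setTI; exact: fo.
Qed.

Lemma continuous_borel (S T : ptopologicalType) (f : S -> T) :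
  continuous f -> measurable_fun setT (f : borel S -> borel T).
Proof.
move=> cf; apply: measurable_to_borel => U oU; apply: open_borel.
by move/continuousP: cf; exact.
Qed.

Lemma measurable_preimageT d d' (S : measurableType d) (T : measurableType d')
    (f : S -> T) (B : set T) : measurable_fun setT f -> measurable B ->
  measurable (f @^-1` B).
Proof. by move=> mf mB; rewrite -[_ @^-1` _]setTI; exact: mf. Qed.

Lemma measurable_forall_fin d (T : measurableType d) (I : finType) (P : I -> T -> Prop) :
  (forall i, measurable [set x | P i x]) -> measurable [set x | forall i, P i x].
Proof.
move=> mP; rewrite (_ : mkset _ = \bigcap_(i in [set: I]) [set x | P i x]).
  by apply: fin_bigcap_measurable => // i _; exact: mP.
by apply/seteqP; split => [x Px i _|x Px i]; [exact: Px|exact: (Px i Logic.I)].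
Qed.

Section image_law.
Context d d' (S : measurableType d) (T : measurableType d') (R : realType)
  (P : probability S R) (f : S -> T).

(** The measurability proof is part of the term, so that the structure of a
    probability can be attached to it. *)
Definition image_measure of measurable_fun [set: S] f := pushforward P f.

Hypothesis mf : measurable_fun [set: S] f.

Let image_mfun : {mfun S >-> T} := mfun_Sub (mem_set mf).

Let image_measure_0 : image_measure mf set0 = 0.
Proof. exact: (measure0 (pushforward P image_mfun)). Qed.

Let image_measure_ge0 B : 0 <= image_measure mf B.
Proof. exact: (measure_ge0 (pushforward P image_mfun)). Qed.

Let image_measure_sigma_additive : semi_sigma_additive (image_measure mf).
Proof. exact: (@measure_semi_sigma_additive _ _ _ (pushforward P image_mfun)). Qed.

HB.instance Definition _ := isMeasure.Build _ _ _ (image_measure mf)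
  image_measure_0 image_measure_ge0 image_measure_sigma_additive.

Let image_measure_setT : image_measure mf setT = 1.
Proof. by rewrite /image_measure/= /pushforward preimage_setT probability_setT. Qed.

HB.instance Definition _ :=
  Measure_isProbability.Build _ _ _ (image_measure mf) image_measure_setT.

Definition image_law : probability T R := image_measure mf.

End image_law.

Lemma is_pushforward_comp d1 d2 d3 (T1 : measurableType d1)
    (T2 : measurableType d2) (T3 : measurableType d3) (R : realType)
    (P1 : probability T1 R) (P2 : probability T2 R) (P3 : probability T3 R)
    (f : T1 -> T2) (g : T2 -> T3) : measurable_fun setT g ->
  is_pushforward f P1 P2 -> is_pushforward g P2 P3 ->
  is_pushforward (g \o f) P1 P3.
Proof.
move=> mg fP gP B mB; rewrite -gP// -[RHS]fP//.
exact: measurable_preimageT.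
Qed.

Section prokhorov_lemmas.
Context (R : realType) (N : nat) (r : {posnum R}).
Implicit Types (A : set (cube N r)) (e f : R)
  (mu nu : probability (borel (cube N r)) R).

Definition thicken e A : set (cube N r) :=
  [set x | exists2 a, A a & (linfty_dist x a < e)%R].

(** The condition on [e] in the definition of the Prokhorov distance.  All
    estimates below are made with this relation; it composes additively
    ([near_measures_trans]), which is the triangle inequality. *)
Definition near_measures e mu nu := forall A : set (borel (cube N r)),
  measurable A -> mu A <= nu (thicken e A) + e%:E /\ nu A <= mu (thicken e A) + e%:E.

Lemma measurable_thicken e A : measurable (thicken e A : set (borel (cube N r))).
Proof.
apply: open_borel.
have -> : thicken e A = \bigcup_(a in A) [set y | (linfty_dist y a < e)%R].
  by apply/seteqP; split => x [a Aa xa]; exists a.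
by apply: bigcup_open => a _; exact: open_linfty_ball.
Qed.

Lemma thickenS e f A : (e <= f)%R -> thicken e A `<=` thicken f A.
Proof. by move=> ef x [a Aa xa]; exists a => //; exact: lt_le_trans ef. Qed.

Lemma sub_thicken e A : (0 < e)%R -> A `<=` thicken e A.
Proof. by move=> e0 x Ax; exists x; rewrite ?linftyxx. Qed.

Lemma thickenD e f A : thicken f (thicken e A) `<=` thicken (e + f) A.
Proof.
move=> x [y [a Aa ya] xy]; exists a => //.
by rewrite (le_lt_trans (linfty_triangle y _ _))// addrC ltrD.
Qed.

Lemma near_measuresW e f mu nu : (e <= f)%R ->
  near_measures e mu nu -> near_measures f mu nu.
Proof.
move=> ef H A mA; have [mn nm] := H A mA.
split; [apply: le_trans mn _|apply: le_trans nm _]; apply: leeD;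
  rewrite ?lee_fin//; apply: le_measure; rewrite ?inE;
  by [exact: measurable_thicken|exact: thickenS].
Qed.

Lemma prokhorov_le e mu nu : (0 < e)%R -> near_measures e mu nu ->
  prokhorov mu nu <= e%:E.
Proof. by move=> e0 H; apply: ereal_inf_lbound; exists e. Qed.

Lemma prokhorov_lt e mu nu : prokhorov mu nu < e%:E -> near_measures e mu nu.
Proof.
move=> /ereal_inf_lt[_ [f [f0 H] <-] fe].
by apply: (@near_measuresW f); rewrite ?(ltW _)// -lte_fin.
Qed.

Lemma near_measures_gt0 e mu nu : prokhorov mu nu < e%:E -> (0 < e)%R.
Proof.
by move=> /ereal_inf_lt[_ [f [f0 H] <-] fe]; rewrite (lt_trans f0)// -lte_fin.
Qed.

Lemma near_measuresC e mu nu : near_measures e mu nu -> near_measures e nu mu.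
Proof. by move=> H A mA; have [? ?] := H A mA. Qed.

Lemma near_measuresxx e mu : (0 < e)%R -> near_measures e mu mu.
Proof.
move=> e0 A mA; suff : mu A <= mu (thicken e A) + e%:E by [].
apply: lee_paddr; first by rewrite lee_fin ltW.
by apply: le_measure; rewrite ?inE//; [exact: measurable_thicken|exact: sub_thicken].
Qed.

Lemma near_measures_trans e f mu nu la : near_measures e mu nu ->
  near_measures f nu la -> near_measures (e + f) mu la.
Proof.
have half e1 e2 (m n l : probability (borel (cube N r)) R) :
    near_measures e1 m n -> near_measures e2 n l ->
    forall A : set (borel (cube N r)), measurable A ->
      m A <= l (thicken (e1 + e2) A) + (e1 + e2)%:E.
  move=> H1 H2 A mA; have [H _] := H1 A mA; apply: (le_trans H).
  have [H' _] := H2 _ (measurable_thicken e1 A).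
  rewrite EFinD (addeC e1%:E) addeA; apply: leeD => //; apply: (le_trans H').
  apply: leeD => //.
  apply: le_measure; rewrite ?inE; [exact: measurable_thicken|exact: measurable_thicken|].
  exact: thickenD.
move=> H1 H2 A mA; split; first exact: (half _ _ _ _ _ H1 H2).
by rewrite (addrC e); apply: (half _ _ _ _ _ (near_measuresC H2) (near_measuresC H1)).
Qed.

Lemma prokhorov_ge0 mu nu : 0 <= prokhorov mu nu.
Proof. by apply: le_ereal_inf_tmp => _ [e [e0 _] <-]; rewrite lee_fin ltW. Qed.

Lemma prokhorov_le1 mu nu : prokhorov mu nu <= 1.
Proof.
apply: prokhorov_le => // A mA; split;
  apply: (le_trans (probability_le1 _ mA)); exact: leeDr.
Qed.

Lemma prokhorovxx mu : prokhorov mu mu = 0.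
Proof.
apply/eqP; rewrite eq_le prokhorov_ge0 andbT; apply/lee_addgt0Pr => e e0.
by rewrite add0e; apply: prokhorov_le => //; exact: near_measuresxx.
Qed.

Lemma prokhorovC mu nu : prokhorov mu nu = prokhorov nu mu.
Proof.
suff H mu1 nu1 : @prokhorov R N r mu1 nu1 <= prokhorov nu1 mu1 by apply/eqP; rewrite eq_le !H.
rewrite {2}/prokhorov; apply: le_ereal_inf_tmp => _ [e [e0 ne] <-].
apply: prokhorov_le => //.
exact: near_measuresC.
Qed.

Lemma prokhorov_fin mu nu : prokhorov mu nu \is a fin_num.
Proof.
rewrite ge0_fin_numE ?prokhorov_ge0//.
by rewrite (le_lt_trans (prokhorov_le1 _ _))// ltry.
Qed.

Lemma prokhorov_triangle mu nu la :
  prokhorov mu la <= prokhorov mu nu + prokhorov nu la.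
Proof.
apply/lee_addgt0Pr => e e0.
have e20 : (0 < e / 2)%R by rewrite divr_gt0.
pose a := fine (prokhorov mu nu); pose b := fine (prokhorov nu la).
have Ha : prokhorov mu nu < (a + e / 2)%:E.
  by rewrite EFinD fineK ?prokhorov_fin// lteDl ?prokhorov_fin.
have Hb : prokhorov nu la < (b + e / 2)%:E.
  by rewrite EFinD fineK ?prokhorov_fin// lteDl ?prokhorov_fin.
apply: (@le_trans _ _ ((a + e / 2) + (b + e / 2))%:E).
  apply: prokhorov_le.
    by rewrite addr_gt0 ?(near_measures_gt0 Ha) ?(near_measures_gt0 Hb).
  by apply: near_measures_trans; apply: prokhorov_lt; eassumption.
by rewrite addrACA -splitr !EFinD !fineK ?prokhorov_fin.
Qed.

End prokhorov_lemmas.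

(** * Couplings that match two finite partitions *)

Lemma measure_finite_map d (T : measurableType d) (R : realType)
    (mu : {measure set T -> \bar R}) (I : finType) (c : T -> I) (B : set T) :
  (forall i, measurable (c @^-1` [set i])) -> measurable B ->
  mu B = \sum_i mu (B `&` c @^-1` [set i]).
Proof.
move=> mc mB; rewrite (fsbig_seq _ _ (index_enum_uniq I)) -measure_fin_bigcup//=.
- congr (mu _); apply/seteqP; split => [x Bx|x [i _ []]//].
  by exists (c x) => //=; rewrite mem_index_enum.
- by move=> i j _ _ [x [[_ <-] [_ <-]]].
- by move=> i _; exact: measurableI.
Qed.

Lemma probability_of_measure d (T : measurableType d) (R : realType)
    (mu : {measure set T -> \bar R}) : mu setT = 1 ->
  exists P : probability T R, forall E, P E = mu E.
Proof.
move=> mu1; exists (mnormalize mu (@dirac _ T point R)) => E.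
apply: (@etrans _ _ (mnormalize mu (@dirac _ T point R) E)) => //.
by rewrite /mnormalize mu1 onee_eq0/= invr1 mule1.
Qed.

(** Used with a product measure and products of cells, this gives a measure
    with a density that is constant on each product of cells. *)
Lemma measure_mixture d (T : measurableType d) (R : realType)
    (mu : {measure set T -> \bar R}) (I : Type) (w : I -> {nonneg R})
    (C : I -> set T) (s : seq I) : (forall i, measurable (C i)) ->
  exists nu : {measure set T -> \bar R}, forall E,
    nu E = \sum_(i <- s) (w i)%:num%:E * mu (E `&` C i).
Proof.
move=> mC; elim: s => [|i s [nu nuE]].
  by exists mzero => E; rewrite big_nil.
exists (measure_add (mscale (w i) (mrestr mu (mC i))) nu) => E.
by apply: etrans (measure_addE _ _ E) _; rewrite nuE big_cons.
Qed.

Lemma le_sume_diag (R : realType) (I : finType) (F : I -> I -> \bar R) :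
  (forall i j, 0 <= F i j) -> \sum_i F i i <= \sum_i \sum_j F i j.
Proof.
move=> F0; apply: lee_sum => i _; rewrite (bigD1 i)//=.
by apply: leeDl; apply: sume_ge0.
Qed.

(** A finite partition coded by a map to [I] on each of two probability spaces.
    The coupling of the cell masses [a] and [b] keeps m = min(a, b) on the
    diagonal and spreads the excess masses a - m and b - m independently; it is
    lifted to the spaces with independence inside each product of cells. *)
Section coupling.
Context d1 d2 (T1 : measurableType d1) (T2 : measurableType d2) (R : realType)
  (P1 : probability T1 R) (P2 : probability T2 R) (I : finType)
  (c1 : T1 -> I) (c2 : T2 -> I).
Hypothesis mc1 : forall i, measurable (c1 @^-1` [set i]).
Hypothesis mc2 : forall i, measurable (c2 @^-1` [set i]).

Let a i := fine (P1 (c1 @^-1` [set i])).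
Let b i := fine (P2 (c2 @^-1` [set i])).
Let m i := Num.min (a i) (b i).
Let s := (\sum_i m i)%R.

Let a0 i : (0 <= a i)%R. Proof. exact: fine_ge0. Qed.
Let b0 i : (0 <= b i)%R. Proof. exact: fine_ge0. Qed.
Let m0 i : (0 <= m i)%R. Proof. by rewrite le_min a0 b0. Qed.
Let ma i : (m i <= a i)%R. Proof. by rewrite ge_min lexx. Qed.
Let mb i : (m i <= b i)%R. Proof. by rewrite ge_min lexx orbT. Qed.

Let aE i : P1 (c1 @^-1` [set i]) = (a i)%:E.
Proof. by rewrite /a fineK// fin_num_measure. Qed.
Let bE i : P2 (c2 @^-1` [set i]) = (b i)%:E.
Proof. by rewrite /b fineK// fin_num_measure. Qed.

Let sum_a : (\sum_i a i = 1)%R.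
Proof.
apply: EFin_inj; rewrite -sumEFin -(probability_setT P1).
rewrite (measure_finite_map _ mc1)//.
by apply: eq_bigr => i _; rewrite setTI -aE.
Qed.

Let sum_b : (\sum_i b i = 1)%R.
Proof.
apply: EFin_inj; rewrite -sumEFin -(probability_setT P2).
rewrite (measure_finite_map _ mc2)//.
by apply: eq_bigr => i _; rewrite setTI -bE.
Qed.

(* When s = 1 the excess masses vanish, and the quotient by 0 is harmless
   because its numerator is 0. *)
Let p i j := (m i *+ (i == j) + (a i - m i) * (b j - m j) / (1 - s))%R.

Let s1 : (s <= 1)%R.
Proof. by rewrite -sum_a; apply: ler_sum. Qed.

Let p0 i j : (0 <= p i j)%R.
Proof.
apply: addr_ge0; first by rewrite mulrn_wge0.
by rewrite divr_ge0 ?mulr_ge0 ?subr_ge0.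
Qed.

Let s1_a i : s = 1%R -> (a i - m i = 0)%R.
Proof.
move=> s_1; have /eqP : (\sum_i (a i - m i) = 0)%R.
  by rewrite sumrB sum_a -/s s_1 subrr.
rewrite psumr_eq0 => [/allP/(_ i)|j _]; last by rewrite subr_ge0.
by rewrite mem_index_enum => /(_ isT)/eqP.
Qed.

Let s1_b i : s = 1%R -> (b i - m i = 0)%R.
Proof.
move=> s_1; have /eqP : (\sum_i (b i - m i) = 0)%R.
  by rewrite sumrB sum_b -/s s_1 subrr.
rewrite psumr_eq0 => [/allP/(_ i)|j _]; last by rewrite subr_ge0.
by rewrite mem_index_enum => /(_ isT)/eqP.
Qed.

Let sum_pr i : (\sum_j p i j = a i)%R.
Proof.
rewrite big_split/= (bigD1 i)//= eqxx mulr1n big1 ?addr0; last first.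
  by move=> j ji; rewrite eq_sym (negbTE ji).
rewrite -mulr_suml -mulr_sumr sumrB sum_b -/s.
have [s_1|s_1] := eqVneq s 1%R.
  by rewrite s1_a// mul0r mul0r addr0; apply/esym/eqP; rewrite -subr_eq0 s1_a.
by rewrite mulfK ?subr_eq0 1?eq_sym// addrC subrK.
Qed.

Let sum_pl j : (\sum_i p i j = b j)%R.
Proof.
rewrite big_split/= (bigD1 j)//= eqxx mulr1n big1 ?addr0; last first.
  by move=> i ij; rewrite (negbTE ij).
rewrite -mulr_suml -mulr_suml sumrB sum_a -/s.
have [s_1|s_1] := eqVneq s 1%R.
  by rewrite s1_b// mulr0 mul0r addr0; apply/esym/eqP; rewrite -subr_eq0 s1_b.
by rewrite mulrAC mulfV ?subr_eq0 1?eq_sym// mul1r addrC subrK.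
Qed.

Let p_a0 i j : a i = 0%R -> p i j = 0%R.
Proof.
move=> ai0; have /eqP := sum_pr i; rewrite ai0 psumr_eq0//.
by move=> /allP/(_ j); rewrite mem_index_enum => /(_ isT)/eqP.
Qed.

Let p_b0 i j : b j = 0%R -> p i j = 0%R.
Proof.
move=> bj0; have /eqP := sum_pl j; rewrite bj0 psumr_eq0//.
by move=> /allP/(_ i); rewrite mem_index_enum => /(_ isT)/eqP.
Qed.

Let w i j := (p i j / (a i * b j))%R.

Let w0 i j : (0 <= w i j)%R.
Proof. by rewrite divr_ge0// mulr_ge0. Qed.

Let sum_wb i : a i != 0%R -> (\sum_j w i j * b j = 1)%R.
Proof.
move=> ai0; rewrite -(@mulfV _ (a i))// -{1}(sum_pr i) mulr_suml.
apply: eq_bigr => j _; rewrite /w.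
have [bj0|bj0] := eqVneq (b j) 0%R; first by rewrite p_b0// !mul0r.
by rewrite invfM mulrA mulfVK.
Qed.

Let sum_wa j : b j != 0%R -> (\sum_i w i j * a i = 1)%R.
Proof.
move=> bj0; rewrite -(@mulfV _ (b j))// -{1}(sum_pl j) mulr_suml.
apply: eq_bigr => i _; rewrite /w.
have [ai0|ai0] := eqVneq (a i) 0%R; first by rewrite p_a0// !mul0r.
by rewrite invfM mulrA mulrAC mulfVK.
Qed.

Let C (ij : I * I) : set (T1 * T2) := c1 @^-1` [set ij.1] `*` c2 @^-1` [set ij.2].

Let mC ij : measurable (C ij).
Proof. exact: measurableX. Qed.

Let prodE A B : measurable A -> measurable B ->
  (P1 \x P2) (A `*` B) = P1 A * P2 B.
Proof. by move=> mA mB; exact: product_measure1E. Qed.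

Lemma finite_coupling : exists pi : probability (T1 * T2)%type R,
  [/\ forall B, measurable B -> pi (fst @^-1` B) = P1 B,
      forall B, measurable B -> pi (snd @^-1` B) = P2 B &
      (\sum_i Num.min (fine (P1 (c1 @^-1` [set i]))) (fine (P2 (c2 @^-1` [set i]))))%:E
        <= pi [set z | c1 z.1 = c2 z.2]].
Proof.
have [nu nuE'] := measure_mixture (P1 \x P2) (fun ij => NngNum (w0 ij.1 ij.2))
  (index_enum _) mC.
have nuE E : nu E = \sum_i \sum_j (w i j)%:E * (P1 \x P2) (E `&` C (i, j)).
  by rewrite nuE' pair_bigA.
have nu1 B : measurable B -> nu (fst @^-1` B) = P1 B.
  move=> mB; rewrite nuE (measure_finite_map _ mc1 mB); apply: eq_bigr => i _.
  have mBi : measurable (B `&` c1 @^-1` [set i]) by exact: measurableI.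
  transitivity (\sum_j P1 (B `&` c1 @^-1` [set i]) * (w i j * b j)%:E).
    apply: eq_bigr => j _; rewrite (_ : _ `&` _ =
      (B `&` c1 @^-1` [set i]) `*` (c2 @^-1` [set j])); last first.
      by rewrite /C; apply/seteqP; split => -[x y]; rewrite /setX/=; tauto.
    by rewrite prodE// bE muleCA -EFinM.
  rewrite -ge0_sume_distrr; last by move=> j _; rewrite lee_fin mulr_ge0.
  rewrite sumEFin; have [ai0|ai0] := eqVneq (a i) 0%R; last by rewrite sum_wb// mule1.
  suff P0 : P1 (B `&` c1 @^-1` [set i]) = 0 by rewrite P0 mul0e; exact/esym/P0.
  apply/eqP; rewrite eq_le measure_ge0 andbT -[leRHS]/(0%R%:E) -ai0 -aE.
  by apply: le_measure; rewrite ?inE.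
have nu2 B : measurable B -> nu (snd @^-1` B) = P2 B.
  move=> mB; rewrite nuE (measure_finite_map _ mc2 mB) exchange_big/=.
  apply: eq_bigr => j _.
  have mBj : measurable (B `&` c2 @^-1` [set j]) by exact: measurableI.
  transitivity (\sum_i P2 (B `&` c2 @^-1` [set j]) * (w i j * a i)%:E).
    apply: eq_bigr => i _; rewrite (_ : _ `&` _ =
      (c1 @^-1` [set i]) `*` (B `&` c2 @^-1` [set j])); last first.
      by rewrite /C; apply/seteqP; split => -[x y]; rewrite /setX/=; tauto.
    by rewrite prodE// aE muleA -EFinM muleC.
  rewrite -ge0_sume_distrr; last by move=> i _; rewrite lee_fin mulr_ge0.
  rewrite sumEFin; have [bj0|bj0] := eqVneq (b j) 0%R; last by rewrite sum_wa// mule1.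
  suff P0 : P2 (B `&` c2 @^-1` [set j]) = 0 by rewrite P0 mul0e.
  apply/eqP; rewrite eq_le measure_ge0 andbT -[leRHS]/(0%R%:E) -bj0 -bE.
  by apply: le_measure; rewrite ?inE.
have nuT : nu setT = 1.
  by rewrite -(preimage_setT (@fst T1 T2)) nu1// probability_setT.
have [pi piE] := probability_of_measure nuT.
exists pi; split => [B mB|B mB|]; rewrite piE; [exact: nu1|exact: nu2|].
rewrite nuE; apply: le_trans (le_sume_diag _); last first.
  by move=> i j; rewrite mule_ge0 ?lee_fin.
rewrite -sumEFin; apply: lee_sum => i _.
rewrite (_ : _ `&` _ = (c1 @^-1` [set i]) `*` (c2 @^-1` [set i])); last first.
  by apply/seteqP; split => -[x y]; rewrite /C /setX/= => -[]; [tauto|move=> -> ->].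
rewrite prodE// aE bE -!EFinM lee_fin -/(a i) -/(b i) -/(m i).
have [ai0|ai0] := eqVneq (a i) 0%R.
  by rewrite ai0 mul0r mulr0 -ai0.
have [bi0|bi0] := eqVneq (b i) 0%R.
  by rewrite bi0 mulr0 mulr0 -bi0.
rewrite /w mulfVK ?mulf_neq0// /p eqxx mulr1n lerDl.
by rewrite divr_ge0 ?mulr_ge0 ?subr_ge0.
Qed.

End coupling.

(** * Topology and Lipschitz functions of qm-spaces *)

Section qmspace_topology.
Context (R : realType).
Implicit Types X Y : qmspace R.

Lemma nbhs_mdist X (x : X) (U : set X) : nbhs x U <->
  exists2 e : R, (0 < e)%R & [set y | (mdist x y < e)%R] `<=` U.
Proof.
split=> [/nbhs_ballP[e /= e0 eU]|[e e0 eU]].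
  by exists e => // y xy; apply: eU; rewrite ballEmdist.
by apply/nbhs_ballP; exists e => // y; rewrite ballEmdist; exact: eU.
Qed.

Lemma open_mdist_ball X (x : X) (e : R) : open [set y | (mdist x y < e)%R].
Proof.
rewrite openE => y /= xy; apply/nbhs_mdist.
exists (e - mdist x y)%R; first by rewrite subr_gt0.
by move=> z /=; rewrite ltrBrDl; apply: le_lt_trans; exact: metric_triangle.
Qed.

(** A sequence rather than a dense countable set, so that countable unions are
    indexed by [nat]. *)
Lemma qm_dense_sequence X : exists s : nat -> X,
  forall x (e : R), (0 < e)%R -> exists n, (mdist x (s n) < e)%R.
Proof.
have [D /countable_injP[f finj] dD] := qm_separable X.
have [s sP] : {s : nat -> X & forall n x, D x -> f x = n -> s n = x}.
  exists (fun n => if pselect (exists2 x, D x & f x = n) is left h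
                   then projT1 (cid2 h) else point) => n x Dx fxn.
  case: pselect => [h|[]]; last by exists x.
  case: cid2 => y Dy fyn /=; apply: finj; rewrite ?inE//.
  by rewrite fyn.
exists s => x e e0.
have [|y [/= xy Dy]] := dD _ _ (open_mdist_ball x e).
  by exists x; rewrite /= mdistxx.
by exists (f y); rewrite (sP _ y).
Qed.

Lemma qdist_le_mdist X (x y : X) : (qdist x y <= mdist x y)%R.
Proof. by rewrite mdistE le_max lexx. Qed.

Lemma Lip1_mdist X (f : X -> R) (x y : X) : Lip1 f ->
  (`|f x - f y| <= mdist x y)%R.
Proof.
move=> fL; have := fL x y; have := fL y x.
have := qdist_le_mdist x y; have := qdist_le_mdist y x.
by rewrite (metric_sym y x) ler_norml => *; apply/andP; split; lra.
Qed.

Lemma Lip1_continuous X (f : X -> R) : Lip1 f -> continuous f.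
Proof.
move=> fL x; apply/cvgrPdist_lt => e e0; apply/nbhs_mdist.
by exists e => // y /= xy; rewrite (le_lt_trans _ xy)// Lip1_mdist.
Qed.

Lemma Lip1_cst X (c : R) : Lip1 (fun _ : X => c).
Proof. by move=> x y; rewrite subrr qdist_ge0. Qed.

Lemma Lip1_qdist X (x0 : X) : Lip1 (qdist x0).
Proof. by move=> x y; rewrite lerBlDl; exact: qdist_triangle. Qed.

(** Both factors are separable, so an open set of the product is a countable
    union of products of balls; hence product measures are defined on the
    Borel sets of the product space. *)
Lemma measurable_prod_borel X Y :
  measurable_fun setT (id : (borel X * borel Y)%type -> borel (X * Y)%type).
Proof.
apply: (@measurable_to_borel _ (borel X * borel Y)%type (X * Y)%type id) => W oW.
have [s sP] := qm_dense_sequence X; have [t tP] := qm_dense_sequence Y.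
pose B (e : R) (i j : nat) : set (X * Y) :=
  [set x | (mdist (s i) x < e)%R] `*` [set y | (mdist (t j) y < e)%R].
have mB e i j : measurable (B e i j : set (borel X * borel Y)%type).
  by apply: measurableX; apply: open_borel; exact: open_mdist_ball.
have -> : id @^-1` W = \bigcup_n \bigcup_i \bigcup_j
    (if `[< B n.+1%:R^-1%R i j `<=` W >] then B n.+1%:R^-1%R i j else set0).
  apply/seteqP; split => [[x y] /= Wxy|xy [n _ [i _ [j _]]]]; last first.
    by case: asboolP => [BW /BW|].
  have : nbhs (x, y) W by apply: open_nbhs_nbhs.
  case=> -[U V] /= [/nbhs_mdist[e e0 eU] /nbhs_mdist[f f0 fV]] UVW.
  pose g := (Num.min e f / 2)%R.
  have g0 : (0 < g)%R by rewrite divr_gt0// lt_min e0.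
  have [n _ nP] := near_infty_natSinv_lt (PosNum g0).
  have ng : (n.+1%:R^-1 < g)%R := nP n (leqnn n).
  have [i xi] := sP x n.+1%:R^-1%R (ltac:(by rewrite invr_gt0)).
  have [j yj] := tP y n.+1%:R^-1%R (ltac:(by rewrite invr_gt0)).
  exists n => //; exists i => //; exists j => //.
  rewrite asboolT; first by split; rewrite /= metric_sym.
  move=> [x' y'] [/= x'i y'j]; apply: UVW; split => /=.
    apply: eU; apply: (le_lt_trans (metric_triangle _ (s i) _)) => /=.
    apply: (@lt_le_trans _ _ (g + g)%R); first by apply: ltrD; exact: lt_trans ng.
    by rewrite -splitr ge_min lexx.
  apply: fV; apply: (le_lt_trans (metric_triangle _ (t j) _)) => /=.
  apply: (@lt_le_trans _ _ (g + g)%R); first by apply: ltrD; exact: lt_trans ng.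
  by rewrite -splitr ge_min lexx orbT.
apply: bigcupT_measurable => n; apply: bigcupT_measurable => i.
apply: bigcupT_measurable => j; case: asboolP => _; [exact: mB|exact: measurable0].
Qed.

(** McShane extension along a relation [G] with small distortion: the function
    y |-> inf over z in G of f z.1 + d(z.2, y) is in Lip1, as an infimum of
    such functions, and the distortion bound keeps it close to [f] along [G]. *)
Lemma Lip1_transfer X Y (G : set (X * Y)) (d : R) (f : X -> R) :
  (forall z z', G z -> G z' ->
     (qdist z.1 z'.1 <= qdist z.2 z'.2 + d)%R) -> G !=set0 -> Lip1 f ->
  exists2 g : Y -> R, Lip1 g & forall z, G z -> (`|f z.1 - g z.2| <= d)%R.
Proof.
move=> Gd [z0 Gz0] fL.
pose E y := [set (f z.1 + qdist z.2 y)%R | z in G].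
have E0 y : E y !=set0 by exists (f z0.1 + qdist z0.2 y)%R, z0.
have Elb y : has_lbound (E y).
  exists (f z0.1 - d - qdist y z0.2)%R => _ [z Gz <-].
  have := fL z.1 z0.1; have := Gd _ _ Gz Gz0; have := qdist_triangle z.2 y z0.2.
  lra.
have Einf y : has_inf (E y) by split.
exists (fun y => inf (E y)).
  move=> y y'; rewrite lerBlDr addrC; rewrite -lerBlDr.
  apply: lb_le_inf => // _ [z Gz <-]; rewrite lerBlDr.
  apply: (@le_trans _ _ (f z.1 + qdist z.2 y')%R).
    by apply: ge_inf => //; exists z.
  by rewrite -addrA lerD2l qdist_triangle.
move=> z Gz; rewrite ler_norml; apply/andP; split; last first.
  rewrite lerBlDl; have : (f z.1 - d <= inf (E z.2))%R.
    apply: lb_le_inf => // _ [z' Gz' <-].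
    have := fL z'.1 z.1; have := Gd _ _ Gz' Gz; lra.
  by rewrite lerBlDr addrC.
have : (inf (E z.2) <= f z.1 + qdist z.2 z.2)%R.
  by apply: ge_inf => //; exists z.
have : (0 <= d)%R by have := Gd _ _ Gz Gz; rewrite !qdistxx add0r.
rewrite qdistxx; lra.
Qed.

End qmspace_topology.

(** * An upper bound for the box distance *)

Section box_bounds.
Context (R : realType).
Implicit Types X Y : qmspace R.

(** Allows estimates on a relation to pass to its closure, since the definition
    of the box distance asks for a closed set. *)
Lemma closed_Lip1_close X Y (f : X -> R) (g : Y -> R) (d : R) :
  Lip1 f -> Lip1 g ->
  closed ([set z | (`|f z.1 - g z.2| <= d)%R] : set (X * Y)).
Proof.
move=> fL gL.
have cont : continuous (fun z : X * Y => `|f z.1 - g z.2|%R).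
  move=> z; apply: (@continuous_comp _ _ _ (fun z : X * Y => f z.1 - g z.2)%R Num.norm);
    last exact: norm_continuous.
  apply: (@continuousB R R^o _ (f \o fst) (g \o snd)).
    apply: continuous_comp; [exact: cvg_fst|exact: Lip1_continuous].
  by apply: continuous_comp; [exact: cvg_snd|exact: Lip1_continuous].
have -> : [set z : X * Y | (`|f z.1 - g z.2| <= d)%R] =
    (fun z : X * Y => `|f z.1 - g z.2|%R) @^-1` [set x | (x <= d)%R] by [].
by apply: closed_comp => //; exact: closed_le.
Qed.

(** The coupling of [finite_coupling] gives mass at least 1 - e to the pairs in
    matching cells, and on these pairs Lip1 functions are transported in both
    directions by [Lip1_transfer]. *)
Lemma box_le X Y (I : finType) (c1 : X -> I) (c2 : Y -> I) (e d : R) :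
  (forall i, measurable (c1 @^-1` [set i] : set (borel X))) ->
  (forall i, measurable (c2 @^-1` [set i] : set (borel Y))) ->
  (0 <= d)%R -> (2 * d <= e)%R ->
  (1 - e <= \sum_i Num.min (fine (qmeasure X (c1 @^-1` [set i])))
                           (fine (qmeasure Y (c2 @^-1` [set i]))))%R ->
  (forall x y x' y', c1 x = c2 y -> c1 x' = c2 y' ->
     (`|qdist x x' - qdist y y'| <= d)%R) ->
  box X Y <= e%:E.
Proof.
move=> mc1 mc2 d0 de le_sum dis.
have [pi0 [pi1 pi2 pi_diag]] := @finite_coupling _ _ (borel X) (borel Y) R
  (qmeasure X) (qmeasure Y) I c1 c2 mc1 mc2.
pose pi : probability (borel (X * Y)%type) R :=
  image_law pi0 (@measurable_prod_borel R X Y).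
pose G : set (X * Y) := [set z | c1 z.1 = c2 z.2].
pose S := closure G.
have cS : closed S by exact: closed_closure.
apply: (@le_trans _ _ (maxe (1 - pi S)
   (2%:E * sup_hausdorff S [set f \o fst | f in @Lip1 R X]
                           [set g \o snd | g in @Lip1 R Y]))).
  apply: ereal_inf_lbound; exists pi, S; split=> //.
rewrite ge_max; apply/andP; split.
  rewrite leeBlDr; last by rewrite fin_num_measure//; exact: closed_borel.
  rewrite -leeBlDl//; apply: (@le_trans _ _ (pi0 G)).
    by apply: le_trans pi_diag; rewrite -EFinB lee_fin.
  rewrite (_ : pi S = pi0 S)//; apply: (@le_measure _ _ _ pi0); rewrite ?inE.
  - have -> : G = \bigcup_(i in [set: I]) (c1 @^-1` [set i] `*` c2 @^-1` [set i]).
      by apply/seteqP; split => [z Gz|z [i _ []] /= c1z c2z]; [exists (c1 z.1)|rewrite /G/= c1z].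
    apply: fin_bigcup_measurable => // i _; exact: measurableX.
  - exact: (measurable_preimageT (@measurable_prod_borel R X Y) (closed_borel cS)).
  - exact: subset_closure.
suff H : sup_hausdorff S [set f \o fst | f in @Lip1 R X]
                         [set g \o snd | g in @Lip1 R Y] <= d%:E.
  apply: (@le_trans _ _ (2%:E * d%:E)); first by apply: lee_wpmul2l.
  by rewrite -EFinM lee_fin.
rewrite /sup_hausdorff; case: asboolP => [_|S0]; first by rewrite lee_fin.
have G0 : G !=set0.
  apply/set0P/eqP => G0; apply: S0; rewrite /S G0; exact: closure0.
have sup_le f g : Lip1 f -> Lip1 g ->
    (forall z, G z -> (`|f z.1 - g z.2| <= d)%R) ->
    sup_dist S (f \o fst) (g \o snd) <= d%:E.
  move=> fL gL fg; apply: ge_ereal_sup => _ [z Sz <-]; rewrite lee_fin /=.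
  have /closure_id cE := @closed_Lip1_close X Y f g d fL gL.
  have : closure [set z | (`|f z.1 - g z.2| <= d)%R] z by apply: closure_subset Sz.
  by rewrite -cE.
apply: hausdorff_le => _ [f fL <-].
  have [||//|g gL fg] := @Lip1_transfer R X Y G d f.
  - move=> z z' Gz Gz'.
    by have := dis _ _ _ _ Gz Gz'; rewrite ler_norml => /andP[]; lra.
  - exact: G0.
  exists (g \o snd); first by exists g.
  exact: sup_le.
pose G' : set (Y * X) := [set z | G (z.2, z.1)].
have G'0 : G' !=set0 by case: G0 => -[x y] Gxy; exists (y, x).
have [||//|g gL fg] := @Lip1_transfer R Y X G' d f.
- move=> z z' Gz Gz'.
  by have := dis _ _ _ _ Gz Gz'; rewrite ler_norml => /andP[]; lra.
- exact: G'0.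
exists (g \o fst); first by exists g.
apply: sup_le => // -[x y] Gxy; rewrite /= distrC; exact: (fg (y, x)).
Qed.

End box_bounds.

(** * Completeness, separability and quasi-metric of the cube *)

Section cube_topology.
Context (R : realType) (N : nat) (r : {posnum R}).
Implicit Types (x y z : cube N r) (e : R).

Lemma cube_of_subproof (t : 'I_N -> R) :
  (forall i, (- r%:num <= t i <= r%:num)%R) -> (\row_i t i)%R \in @cube_set R N r.
Proof. by move=> H; apply/mem_set => i; rewrite mxE. Qed.

Definition cube_of (t : 'I_N -> R)
    (H : forall i, (- r%:num <= t i <= r%:num)%R) : cube N r :=
  exist (fun v => v \in @cube_set R N r) _ (cube_of_subproof H).

(** Coordinatewise completeness of R; the bounds of the cube are closed
    conditions. *)
Lemma cube_complete (F : set_system (cube N r)) : ProperFilter F ->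
  (forall e, (0 < e)%R -> exists x, F [set y | (linfty_dist y x < e)%R]) ->
  exists x, forall e, (0 < e)%R -> F [set y | (linfty_dist y x < e)%R].
Proof.
move=> PF FC; pose f i (x : cube N r) : R^o := val x ord0 i.
have fC i : cauchy (f i @ F).
  apply: cauchy_exP => e /FC[x Fx]; exists (f i x).
  suff : F (f i @^-1` ball (f i x) e) by [].
  apply: filterS Fx => y xy /=.
  rewrite /ball /= distrC; apply: le_lt_trans xy; exact: le_linfty.
have fl i : exists l : R^o, f i @ F --> l.
  have : cvg (f i @ F) by apply: cauchy_cvg; exact: fC.
  by move=> /cvg_ex.
pose l i := projT1 (cid (fl i)); have lP i : f i @ F --> l i by rewrite /l; case: cid.
have lr i : (- r%:num <= l i <= r%:num)%R.
  have := @closed_cvg _ _ _ PF (f i) [set x | (- r%:num <= x <= r%:num)%R].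
  apply; last exact: lP.
    have -> : [set x | (- r%:num <= x <= r%:num)%R] =
        [set x | (- r%:num <= x)%R] `&` [set x | (x <= r%:num)%R].
      by apply/seteqP; split => t /= /andP.
    by apply: closedI; [exact: closed_ge|exact: closed_le].
  by apply: nearW => x; exact: cube_le.
exists (cube_of lr) => e e0.
have : \forall y \near F, forall i, (`|l i - f i y| < e)%R.
  by apply: filter_forall => i; move/cvgrPdist_lt: (lP i); apply.
by apply: filterS => y Hy; apply/linfty_ltP => // i; rewrite mxE distrC; exact: Hy.
Qed.

(** One point of the cube is chosen in each box of R^N with rational center and
    radius that meets the cube. *)
Lemma cube_dense_sequence : exists s : nat -> cube N r,
  forall x e, (0 < e)%R -> exists n, (linfty_dist x (s n) < e)%R.
Proof.
pose near_pt (cq : 'rV[rat]_N * rat) (p : cube N r) :=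
  forall i, (`|val p ord0 i - ratr (cq.1 ord0 i)| < ratr cq.2)%R.
pose s n : cube N r := if @unpickle ('rV[rat]_N * rat)%type n is Some cq then
  (if pselect (exists p, near_pt cq p) is left h then projT1 (cid h) else point)
  else point.
exists s => x e e0.
have e20 : (0 < e / 2)%R by rewrite divr_gt0.
have [q /[!in_itv]/= /andP[q0 qe]] := rat_in_itvoo e20.
have cP i : exists c : rat, (`|val x ord0 i - ratr c| < ratr q)%R.
  have [|c /[!in_itv]/= /andP[c1 c2]] :=
    @rat_in_itvoo R (val x ord0 i - ratr q)%R (val x ord0 i + ratr q)%R; first lra.
  by exists c; rewrite ltr_distlC; apply/andP; split; lra.
pose cq : 'rV[rat]_N * rat := (\row_i projT1 (cid (cP i)), q).
have xcq : near_pt cq x.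
  by move=> i; rewrite /cq /= mxE; case: cid.
exists (pickle cq); rewrite /s pickleK.
case: pselect => [h|[]]; last by exists x.
case: cid => p /= pcq; apply/linfty_ltP => // i.
have := xcq i; have := pcq i; rewrite /= !ltr_distlC => /andP[? ?] /andP[? ?].
by apply/andP; split; lra.
Qed.

(** The smallest quasi-metric on the cube for which all the coordinates are in
    Lip1; its symmetrization is [linfty_dist] ([linfty_max]). *)
Definition cube_qdist x y : R :=
  \big[Num.max/0%R]_(i < N) (val y ord0 i - val x ord0 i)%R.

Lemma cube_qdist_ge0 x y : (0 <= cube_qdist x y)%R.
Proof. exact: bigmax_ge_id. Qed.

Lemma cube_qdistP x y e : (0 <= e)%R ->
  (cube_qdist x y <= e)%R <-> forall i, (val y ord0 i - val x ord0 i <= e)%R.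
Proof.
move=> e0; split=> [/bigmax_leP[_ H] i|H]; first exact: H.
by apply/bigmax_leP; split.
Qed.

Lemma le_cube_qdist x y i : (val y ord0 i - val x ord0 i <= cube_qdist x y)%R.
Proof. rewrite /cube_qdist; exact: le_bigmax. Qed.

Lemma cube_qdistxx x : cube_qdist x x = 0%R.
Proof.
apply/eqP; rewrite eq_le cube_qdist_ge0 andbT; apply/cube_qdistP => // i.
by rewrite subrr.
Qed.

Lemma cube_qdist_triangle x y z :
  (cube_qdist x z <= cube_qdist x y + cube_qdist y z)%R.
Proof.
apply/cube_qdistP => [|i]; first by rewrite addr_ge0 ?cube_qdist_ge0.
by have := le_cube_qdist x y i; have := le_cube_qdist y z i; lra.
Qed.

Lemma cube_qdist_le_linfty x y : (cube_qdist x y <= linfty_dist x y)%R.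
Proof.
apply/cube_qdistP => [|i]; first exact: linfty_ge0.
by rewrite (le_trans (ler_norm _))// distrC le_linfty.
Qed.

Lemma linfty_max x y : linfty_dist x y = Num.max (cube_qdist x y) (cube_qdist y x).
Proof.
apply/eqP; rewrite eq_le ge_max cube_qdist_le_linfty.
have -> : (cube_qdist y x <= linfty_dist x y)%R.
  by rewrite linftyC cube_qdist_le_linfty.
rewrite !andbT.
apply/linfty_leP => [|i]; first by rewrite le_max cube_qdist_ge0.
have := le_cube_qdist x y i; have := le_cube_qdist y x i; rewrite le_max.
case: (ger0P (val x ord0 i - val y ord0 i)%R) => _; first by move=> ->; rewrite orbT.
by rewrite opprB => _ ->.
Qed.

End cube_topology.

(** * The support of a measure on the cube as a qm-space *)

Section support.
Context (R : realType) (N : nat) (r : {posnum R}).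
Variable nu : probability (borel (cube N r)) R.

Definition msupport : set (cube N r) :=
  [set x | forall U : set (cube N r), open U -> U x -> 0 < nu U].

Lemma closed_support : closed msupport.
Proof.
move=> x clx U oU Ux.
by have [y [Sy Uy]] := clx U (open_nbhs_nbhs (conj oU Ux)); exact: Sy.
Qed.

(** The complement of the support is covered by the balls of measure 0 among a
    countable family that is a base of the topology. *)
Lemma support_full : nu (~` msupport) = 0.
Proof.
have [s sP] := @cube_dense_sequence R N r.
pose B n k : set (cube N r) := [set y | (linfty_dist y (s n) < k.+1%:R^-1)%R].
pose F n k : set (cube N r) := if nu (B n k) == 0 then B n k else set0.
apply: measure_negligible.
  apply: measurableC; apply: closed_borel; exact: closed_support.
have sub : ~` msupport `<=` \bigcup_n \bigcup_k F n k.
  move=> x /existsNP[U /not_implyP[oU /not_implyP[Ux /negP]]].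
  rewrite lt_neqAle measure_ge0 andbT negbK => /eqP U0.
  have [e e0 eU] := nbhs_linfty (open_nbhs_nbhs (conj oU Ux)).
  have e20 : (0 < e / 2)%R by rewrite divr_gt0.
  have [k _ kP] := near_infty_natSinv_lt (PosNum e20).
  have ke : (k.+1%:R^-1 < e / 2)%R := kP k (leqnn k).
  have k0 : (0 < k.+1%:R^-1 :> R)%R by rewrite invr_gt0.
  have [n xn] := sP x _ k0.
  exists n => //; exists k => //; rewrite /F ifT//; apply/eqP.
  apply/eqP; rewrite eq_le measure_ge0 andbT U0; apply: le_measure; rewrite ?inE.
  - by apply: open_borel; exact: open_linfty_ball.
  - exact: open_borel.
  - move=> y /= yn; apply: eU => /=.
    move: (linfty_triangle (s n) y x) yn xn ke; rewrite /B /= (linftyC (s n) x).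
    by move: (k.+1%:R^-1)%R => h; lra.
apply: (@negligibleS _ (borel (cube N r)) R nu _ _ sub).
apply: negligible_bigcup => n; apply: negligible_bigcup => k; rewrite /F.
case: ifPn => [/eqP Bnk0|_]; last exact: negligible_set0.
apply/negligibleP => //; apply: open_borel; exact: open_linfty_ball.
Qed.

Lemma measure_support (A : set (borel (cube N r))) : measurable A ->
  nu A = nu (A `&` msupport).
Proof.
move=> mA; have mS : measurable (msupport : set (borel (cube N r))).
  by apply: closed_borel; exact: closed_support.
apply/eqP; rewrite eq_le; apply/andP; split; last first.
  by apply: le_measure; rewrite ?inE//; exact: measurableI.
rewrite -[leRHS]adde0 -support_full -measureU//.
- apply: le_measure; rewrite ?inE//.
    by apply: measurableU; [exact: measurableI|exact: measurableC].
  by move=> x Ax; have [Sx|Sx] := pselect (msupport x); [left|right].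
- exact: measurableI.
- exact: measurableC.
- by apply/seteqP; split => x // -[[_ Sx]].
Qed.

Lemma support_nonempty : exists x, msupport x.
Proof.
apply: contrapT => S0; have : nu setT = 0.
  rewrite measure_support// (_ : _ `&` _ = set0) ?measure0//.
  by apply/seteqP; split => x // -[_ Sx]; apply: S0; exists x.
by rewrite probability_setT => /eqP; rewrite onee_eq0.
Qed.

Definition support_space : Type := set_type msupport.

HB.instance Definition _ := Choice.on support_space.

Definition support_point : support_space :=
  let: h := cid support_nonempty in exist (fun x => x \in msupport) _ (mem_set (projT2 h)).

HB.instance Definition _ := isPointed.Build support_space support_point.

Definition support_dist (x y : support_space) : R := linfty_dist (val x) (val y).

Let support_distxx x : support_dist x x = 0%R.
Proof. exact: linftyxx. Qed.

Let support_dist_eq0 x y : support_dist x y = 0%R -> x = y.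
Proof. by move/linfty_eq0/val_inj. Qed.

Let support_distC x y : support_dist x y = support_dist y x.
Proof. exact: linftyC. Qed.

Let support_dist_triangle y x z :
  (support_dist x z <= support_dist x y + support_dist y z)%R.
Proof. exact: linfty_triangle. Qed.

HB.instance Definition _ := isMetric.Build R support_space support_distxx
  support_dist_eq0 support_distC support_dist_triangle.

Let support_cauchy_cvg (F : set_system support_space) :
  ProperFilter F -> cauchy F -> cvg F.
Proof.
move=> PF /cauchyP FC.
have [e e0|x xP] := @cube_complete R N r (val @ F) _.
  have [y Fy] := FC e e0; exists (val y).
  suff : F (val @^-1` [set z | (linfty_dist z (val y) < e)%R]) by [].
  by apply: filterS Fy => z; rewrite ballEmdist /= linftyC.
have Sx : msupport x.
  move=> U oU Ux; have [e e0 eU] := nbhs_linfty (open_nbhs_nbhs (conj oU Ux)).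
  have : F (val @^-1` [set z | (linfty_dist z x < e)%R]) by exact: xP.
  move=> /filter_ex[y /= /eU Uy].
  by have /set_mem := valP y; apply.
apply/cvg_ex; exists (exist (fun x => x \in msupport) x (mem_set Sx)).
apply/cvg_ballP => e e0.
have : F (val @^-1` [set z | (linfty_dist z x < e)%R]) by exact: xP.
by apply: filterS => y; rewrite ballEmdist /= linftyC.
Qed.

HB.instance Definition _ := Uniform_isComplete.Build support_space support_cauchy_cvg.

Definition support_qdist (x y : support_space) : R := cube_qdist (val x) (val y).

Lemma support_mdistE (x y : support_space) :
  mdist x y = Num.max (support_qdist x y) (support_qdist y x).
Proof. exact: linfty_max. Qed.

End support.

Section support_qmspace.
Context (R : realType) (N : nat) (r : {posnum R}).
Variable nu : probability (borel (cube N r)) R.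
Local Notation Y := (support_space nu).

(** Retracts the cube onto the support, sending the null complement to a base
    point; the image of [nu] is then a measure on the support. *)
Definition support_retract (x : cube N r) : Y :=
  if pselect (msupport nu x) is left h
  then exist (fun x => x \in msupport nu) x (mem_set h) else support_point nu.

Lemma support_retractK (x : cube N r) : msupport nu x -> val (support_retract x) = x.
Proof. by move=> Sx; rewrite /support_retract; case: pselect. Qed.

Lemma nbhs_support_dist (x : Y) (U : set Y) : nbhs x U <->
  exists2 e : R, (0 < e)%R & [set y | (linfty_dist (val x) (val y) < e)%R] `<=` U.
Proof.
split=> [/nbhs_ballP[e /= e0 eU]|[e e0 eU]].
  by exists e => // y xy; apply: eU; rewrite ballEmdist.
by apply/nbhs_ballP; exists e => // y; rewrite ballEmdist; exact: eU.
Qed.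

Lemma continuous_support_val : continuous (val : Y -> cube N r).
Proof.
move=> y U /nbhs_linfty[e e0 eU]; apply/nbhs_support_dist; exists e => // z /=.
by rewrite linftyC => zy; exact: eU.
Qed.

Lemma measurable_support_retract :
  measurable_fun setT (support_retract : borel (cube N r) -> borel Y).
Proof.
apply: measurable_to_borel => U oU.
have mS : measurable (msupport nu : set (borel (cube N r))).
  by apply: closed_borel; exact: closed_support.
(* an open set of the cube that cuts out [U] on the support *)
pose V : set (cube N r) := \bigcup_(xe in [set xe : Y * R |
  [set y | (linfty_dist (val y) (val xe.1) < xe.2)%R] `<=` U])
  [set y | (linfty_dist y (val xe.1) < xe.2)%R].
have oV : open V by apply: bigcup_open => xe _; exact: open_linfty_ball.
have VU y : U y <-> V (val y).
  split=> [Uy|[xe /= xeU yxe]]; last exact: xeU.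
  have /nbhs_support_dist[e e0 eU] := open_nbhs_nbhs (conj oU Uy).
  exists (y, e) => /=; last by rewrite linftyxx.
  by move=> z /=; rewrite linftyC; exact: eU.
have -> : support_retract @^-1` U = (V `&` msupport nu) `|`
    (if `[< U (support_point nu) >] then ~` msupport nu else set0).
  apply/seteqP; split => x /=; rewrite /support_retract.
    case: pselect => [Sx /VU Vx|Sx Up]; first by left.
    by right; rewrite asboolT.
  case: pselect => [Sx [[Vx _]|]|Sx [[]//|]].
  - exact/VU.
  - by case: asboolP => // _ /(_ Sx).
  - by case: asboolP.
apply: measurableU; first by apply: measurableI => //; exact: open_borel.
by case: asboolP => _; [exact: measurableC|exact: measurable0].
Qed.

Definition support_measure : probability (borel Y) R :=
  image_law nu measurable_support_retract.

Lemma support_measureE (B : set (borel Y)) :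
  support_measure B = nu (support_retract @^-1` B).
Proof. by []. Qed.

Lemma support_measure_val : is_pushforward (val : borel Y -> borel (cube N r))
  support_measure nu.
Proof.
move=> B mB; rewrite /pushforward support_measureE.
have mB' : measurable (support_retract @^-1` (val @^-1` B) : set (borel (cube N r))).
  apply: (measurable_preimageT measurable_support_retract).
  apply: (measurable_preimageT _ mB); apply: continuous_borel.
  exact: continuous_support_val.
rewrite (measure_support nu mB') (measure_support nu mB); congr (nu _).
apply/seteqP; split => x [/= Bx Sx]; split => //.
  by move: Bx; rewrite support_retractK.
by rewrite /= support_retractK.
Qed.

Lemma support_separable : exists2 D : set Y, countable D & dense D.
Proof.
have [s sP] := @cube_dense_sequence R N r.
pose t (nk : nat * nat) : Y :=
  if pselect (exists y : Y, (linfty_dist (val y) (s nk.1) < nk.2.+1%:R^-1)%R) is left h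
  then projT1 (cid h) else support_point nu.
exists (range t).
  by apply: card_le_trans (card_image_le _ _) _; exact: countableP.
move=> U [y Uy] oU.
have /nbhs_support_dist[e e0 eU] := open_nbhs_nbhs (conj oU Uy).
have e20 : (0 < e / 2)%R by rewrite divr_gt0.
have [k _ kP] := near_infty_natSinv_lt (PosNum e20).
have ke : (k.+1%:R^-1 < e / 2)%R := kP k (leqnn k).
have k0 : (0 < k.+1%:R^-1 :> R)%R by rewrite invr_gt0.
have [n yn] := sP (val y) _ k0.
exists (t (n, k)); split; last by exists (n, k).
rewrite /t; case: pselect => [h|[]]; last by exists y.
case: cid => z /= zn; apply: eU => /=.
move: (linfty_triangle (s n) (val y) (val z)) yn zn ke; rewrite (linftyC (s n)).
by move: (k.+1%:R^-1)%R => h'; lra.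
Qed.

Lemma support_measure_full (U : set Y) : open U -> U !=set0 -> 0 < support_measure U.
Proof.
move=> oU [y Uy].
have /nbhs_support_dist[e e0 eU] := open_nbhs_nbhs (conj oU Uy).
pose V : set (cube N r) := [set x | (linfty_dist x (val y) < e)%R].
have oV : open V by exact: open_linfty_ball.
have Vy : V (val y) by rewrite /V /= linftyxx.
have Sy : msupport nu (val y) := set_mem (valP y).
have mS : measurable (msupport nu : set (borel (cube N r))).
  by apply: closed_borel; exact: closed_support.
apply: (lt_le_trans (Sy V oV Vy)); rewrite (measure_support nu (open_borel oV)).
rewrite support_measureE; apply: le_measure; rewrite ?inE.
- by apply: measurableI => //; exact: open_borel.
- by apply: (measurable_preimageT measurable_support_retract); exact: open_borel.
- by move=> x [Vx Sx]; apply: eU => /=; rewrite support_retractK// linftyC.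
Qed.

Definition support_qm : qmspace R := @QMSpace R Y (@support_qdist R N r nu)
  (fun x y => cube_qdist_ge0 _ _) (fun x => cube_qdistxx _)
  (fun x y z => cube_qdist_triangle _ _ _)
  (@support_mdistE R N r nu) support_separable support_measure support_measure_full.

Lemma isomorphic_refl (X : qmspace R) : isomorphic X X.
Proof. by exists id; split => //; exists id. Qed.

Definition support_class : isoclass R :=
  IsoClass (ex_intro (fun X => isomorphic support_qm = isomorphic X) support_qm erefl).

Lemma representativeE (A : isoclass R) : members A = isomorphic A.
Proof. by rewrite /representative; case: cid. Qed.

(** The representative of a class is an arbitrary choice, known only up to
    isomorphism. *)
Lemma support_class_iso : isomorphic support_class support_qm /\
  isomorphic support_qm support_class.
Proof.
have E : isomorphic support_qm = isomorphic support_class :=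
  representativeE support_class.
by split; [rewrite -E|rewrite E]; exact: isomorphic_refl.
Qed.

End support_qmspace.

(** * Measurements and support spaces *)

Section truncation.
Context (R : realType).
Implicit Types (r : {posnum R}) (s t : R).

Lemma truncate_sub_le r s t (d : R) : (0 <= d)%R -> (t - s <= d)%R ->
  (truncate r t - truncate r s <= d)%R.
Proof.
move=> d0 ts; rewrite /truncate; have : (0 < r%:num)%R by [].
move: r%:num => c c0.
case: (leP t c) => tc; case: (leP s c) => sc.
- by case: (leP (- c)%R t); case: (leP (- c)%R s); lra.
- by case: (leP (- c)%R t); case: (leP (- c)%R c); lra.
- by case: (leP (- c)%R s); case: (leP (- c)%R c); lra.
- by lra.
Qed.

Lemma truncate_id r t : (- r%:num <= t <= r%:num)%R -> truncate r t = t.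
Proof. by move=> /andP[rt tr]; rewrite /truncate min_l// max_r. Qed.

Lemma truncate_truncate r r' t : (r%:num <= r'%:num)%R ->
  truncate r (truncate r' t) = truncate r t.
Proof.
rewrite /truncate; have : (0 < r%:num)%R by [].
move: r%:num => c c0; move: r'%:num => c' cc'.
case: (leP t c') => tc'; case: (leP t c) => tc; try lra.
- case: (leP (- c')%R t) => ?.
    by case: (leP t c) => ?; lra.
  case: (leP (- c')%R c) => ?; last lra.
  by rewrite !max_l; lra.
- case: (leP (- c')%R t) => ?; last lra.
  by case: (leP t c) => ?; lra.
- case: (leP (- c')%R c') => ?; last lra.
  by case: (leP c' c) => ?; [have -> : c' = c by lra|].
Qed.

Lemma truncate_dist_le r s t :
  (`|truncate r s - truncate r t| <= `|s - t|)%R.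
Proof.
rewrite ler_norml; apply/andP; split.
  rewrite lerNl opprB; apply: truncate_sub_le => //.
  by rewrite -normrN opprB ler_norm.
by apply: truncate_sub_le => //; exact: ler_norm.
Qed.

End truncation.

Section measurement_lemmas.
Context (R : realType).
Implicit Types (X : qmspace R) (N : nat) (r : {posnum R}).

Lemma truncated_map_coord X N r (f : 'I_N -> X -> R) (x : X) i :
  val (truncated_map r f x) ord0 i = truncate r (f i x).
Proof. by rewrite /= mxE. Qed.

Lemma truncated_map_qdist X N r (f : 'I_N -> X -> R) (x x' : X) :
  (forall i, Lip1 (f i)) ->
  (cube_qdist (truncated_map r f x) (truncated_map r f x') <= qdist x x')%R.
Proof.
move=> fL; apply/cube_qdistP => [|i]; first exact: qdist_ge0.
by rewrite !truncated_map_coord; apply: truncate_sub_le; [exact: qdist_ge0|exact: fL].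
Qed.

Lemma truncated_map_linfty X N r (f : 'I_N -> X -> R) (x x' : X) :
  (forall i, Lip1 (f i)) ->
  (linfty_dist (truncated_map r f x) (truncated_map r f x') <= mdist x x')%R.
Proof.
move=> fL; rewrite linfty_max mdistE ge_max !le_max.
by rewrite !truncated_map_qdist// orbT.
Qed.

Lemma continuous_truncated_map X N r (f : 'I_N -> X -> R) :
  (forall i, Lip1 (f i)) -> continuous (truncated_map r f).
Proof.
move=> fL x U /nbhs_linfty[e e0 eU]; apply/nbhs_mdist; exists e => // y /= xy.
by apply: eU => /=; rewrite linftyC (le_lt_trans _ xy)// truncated_map_linfty.
Qed.

Lemma measurable_truncated_map X N r (f : 'I_N -> X -> R) :
  (forall i, Lip1 (f i)) ->
  measurable_fun setT (truncated_map r f : borel X -> borel (cube N r)).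
Proof. by move=> fL; apply: continuous_borel; exact: continuous_truncated_map. Qed.

Definition truncated_law X N r (f : 'I_N -> X -> R) (fL : forall i, Lip1 (f i)) :
  probability (borel (cube N r)) R := image_law (qmeasure X) (@measurable_truncated_map X N r f fL).

Lemma measurement_truncated_law X N r (f : 'I_N -> X -> R)
    (fL : forall i, Lip1 (f i)) : measurement X (@truncated_law X N r f fL).
Proof. by exists f. Qed.

Lemma isometry_continuous X (Y : qmspace R) (phi : X -> Y) :
  (forall x x', qdist (phi x) (phi x') = qdist x x') -> continuous phi.
Proof.
move=> phiE x U /nbhs_mdist[e e0 eU]; apply/nbhs_mdist; exists e => // y /= xy.
by apply: eU => /=; rewrite mdistE !phiE -mdistE.
Qed.

(** All that is used of the representative of [support_class nu]. *)
Lemma support_class_embedding N r (nu : probability (borel (cube N r)) R) :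
  exists v : support_class nu -> cube N r,
    [/\ forall x x', qdist x x' = cube_qdist (v x) (v x'),
        measurable_fun setT (v : borel (support_class nu) -> borel (cube N r)) &
        is_pushforward (v : borel (support_class nu) -> borel (cube N r))
          (qmeasure (support_class nu)) nu].
Proof.
have [[phi [_ phiE phiP]] _] := support_class_iso nu.
have mphi : measurable_fun setT (phi : borel (support_class nu) -> borel (support_qm nu)).
  by apply: continuous_borel; exact: isometry_continuous.
have mval : measurable_fun setT (val : borel (support_space nu) -> borel (cube N r)).
  by apply: continuous_borel; exact: continuous_support_val.
exists (fun x => val (phi x)); split.
- by move=> x x'; rewrite -phiE.
- exact: (measurableT_comp mval mphi).
- exact: (is_pushforward_comp mval phiP (@support_measure_val R N r nu)).
Qed.

(** The truncated map that produces [nu] takes its values in the support of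
    [nu] at every point, because it is continuous and the measure of X has full
    support; it is the domination. *)
Lemma support_class_dominated X N r (nu : probability (borel (cube N r)) R) :
  measurement X nu -> dominated (support_class nu) X.
Proof.
move=> [f [fL fP]].
have [_ [psi [_ psiE psiP]]] := support_class_iso nu.
have mpsi : measurable_fun setT (psi : borel (support_qm nu) -> borel (support_class nu)).
  by apply: continuous_borel; exact: isometry_continuous.
have fS x : msupport nu (truncated_map r f x).
  move=> U oU Ux; rewrite -fP; last exact: open_borel.
  apply: qmeasure_full_support; last by exists x.
  by move/continuousP : (@continuous_truncated_map X N r f fL); exact.
exists (fun x => psi (support_retract nu (truncated_map r f x))); split; last first.
  move=> x x'; rewrite psiE /= /support_qdist !support_retractK//.
  exact: truncated_map_qdist.
apply: (is_pushforward_comp mpsi _ psiP).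
apply: (is_pushforward_comp (@measurable_support_retract R N r nu) fP).
by [].
Qed.

Lemma support_class_measurement N r (nu : probability (borel (cube N r)) R) :
  measurement (support_class nu) nu.
Proof.
have [v [vE mv vP]] := support_class_embedding nu.
exists (fun i x => val (v x) ord0 i); split.
  by move=> i x y; rewrite vE le_cube_qdist.
rewrite (_ : truncated_map _ _ = v)//; apply/funext => x.
by apply/val_inj/rowP => i; rewrite truncated_map_coord truncate_id// cube_le.
Qed.

End measurement_lemmas.

(** * Grids in the cube *)


Section grid.
Context (R : realType) (N : nat) (r : {posnum R}).
Implicit Types (x y : cube N r) (s : R) (k : nat).

(** On which side of the j-th hyperplane of mesh 1 / (k + 1), in direction i,
    lies the point [x], after a shift of the coordinates by [s]. *)
Definition grid_bit s k (i : 'I_N) (j : nat) x : bool :=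
  (- r%:num + j%:R / k.+1%:R <= val x ord0 i + s)%R.

(** Enough hyperplanes to have one beyond the upper face of the cube. *)
Definition grid_size k : nat := (Num.trunc (2 * r%:num * k.+1%:R : R)%R).+2.

(** The hyperplanes just below and just above [x] in direction i bound the i-th
    coordinate of [y]. *)
Lemma grid_close s k x y : (0 <= s)%R ->
  (forall i (j : 'I_(grid_size k)), grid_bit 0 k i j x = grid_bit s k i j y) ->
  (linfty_dist x y <= k.+1%:R^-1 + s)%R.
Proof.
move=> s0 H; have k0 : (0 < k.+1%:R^-1 :> R)%R by rewrite invr_gt0.
apply/linfty_leP => [|i]; first by rewrite addr_ge0// ltW.
have /andP[x1 x2] := cube_le x i.
pose t := ((val x ord0 i + r%:num) * k.+1%:R)%R.
have t0 : (0 <= t)%R by rewrite mulr_ge0//; lra.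
pose j := Num.trunc t; have /andP[j1 j2] := truncn_itv t0; rewrite -/j in j1 j2.
have jM : (j.+1 < grid_size k)%N.
  rewrite /grid_size !ltnS; apply: le_truncn; rewrite /t ler_wpM2r//; lra.
have := H i (Ordinal jM); have := H i (Ordinal (ltnW jM)).
have tE : (t / k.+1%:R = val x ord0 i + r%:num)%R by rewrite /t mulfK.
have a1 : (j%:R / k.+1%:R <= val x ord0 i + r%:num)%R by rewrite -tE ler_wpM2r// ltW.
have jS : (j.+1%:R / k.+1%:R = j%:R / k.+1%:R + k.+1%:R^-1 :> R)%R.
  by rewrite -natr1 mulrDl mul1r.
have a2 : (val x ord0 i + r%:num < j%:R / k.+1%:R + k.+1%:R^-1)%R.
  by rewrite -tE -jS ltr_pM2r.
move: a1 a2; rewrite /grid_bit /= !addr0 jS.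
move: k0 (j%:R / k.+1%:R)%R => + a; move: (k.+1%:R^-1)%R => h h0 a1 a2.
have -> : (- r%:num + a <= val x ord0 i)%R by lra.
have /negbTE -> : ~~ (- r%:num + (a + h) <= val x ord0 i)%R by rewrite -ltNge; lra.
move=> /esym y1 /esym/negbT; rewrite -ltNge => y2.
by rewrite ler_norml; apply/andP; split; lra.
Qed.

Lemma closed_grid_bit s k i j : closed [set x | grid_bit s k i j x].
Proof.
have -> : [set x | grid_bit s k i j x] = (fun x : cube N r => val x ord0 i) @^-1`
    [set t : R | (- r%:num + j%:R / k.+1%:R - s <= t)%R].
  by apply/seteqP; split => x /=; rewrite /grid_bit lerBlDr.
apply: closed_comp; last exact: closed_ge.
by move=> x _; exact: coord_continuous_cube.
Qed.

Lemma measurable_grid_bit s k i j (b : bool) :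
  measurable ([set x | grid_bit s k i j x = b] : set (borel (cube N r))).
Proof.
have m : measurable ([set x | grid_bit s k i j x] : set (borel (cube N r))).
  by apply: closed_borel; exact: closed_grid_bit.
case: b; first exact: m.
rewrite (_ : mkset _ = ~` [set x | grid_bit s k i j x]); first exact: measurableC.
by apply/seteqP; split => [x /= ->|x /= /negP/negbTE].
Qed.

Definition grid_cell s k x : {ffun 'I_N * 'I_(grid_size k) -> bool} :=
  [ffun p : 'I_N * 'I_(grid_size k) => grid_bit s k p.1 p.2 x].

Lemma measurable_grid_cell s k b :
  measurable (grid_cell s k @^-1` [set b] : set (borel (cube N r))).
Proof.
rewrite (_ : _ @^-1` _ = [set x | forall p : 'I_N * 'I_(grid_size k),
    grid_bit s k p.1 p.2 x = b p]).
  by apply: measurable_forall_fin => p; exact: measurable_grid_bit.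
apply/seteqP; split => x /=; first by move=> /ffunP H p; have := H p; rewrite ffunE.
by move=> H; apply/ffunP => p; rewrite ffunE.
Qed.

(** The points above which, in every direction, no hyperplane lies within
    distance s + s.  If y is within s of such a point x, then shifting y up by
    s moves it past no hyperplane above x and above all those below x, so the
    shifted cell of y is the cell of x ([grid_stable_cell]). *)
Definition grid_stable s k : set (cube N r) :=
  [set x | grid_cell 0 k x = grid_cell (s + s) k x].

Lemma measurable_grid_stable s k : measurable (grid_stable s k : set (borel (cube N r))).
Proof.
rewrite (_ : grid_stable s k = \bigcup_(b in [set: {ffun 'I_N * 'I_(grid_size k) -> bool}])
    (grid_cell 0 k @^-1` [set b] `&` grid_cell (s + s) k @^-1` [set b])).
  apply: fin_bigcup_measurable => // b _.
  by apply: measurableI; exact: measurable_grid_cell.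
apply/seteqP; split => [x Sx|x [b _ [/= <-]]//].
by exists (grid_cell 0 k x) => //; split.
Qed.

Lemma grid_stable_cell s k x y : grid_stable s k x -> (linfty_dist y x < s)%R ->
  grid_cell s k y = grid_cell 0 k x.
Proof.
move=> Sx yx; have s0 : (0 < s)%R by rewrite (le_lt_trans _ yx)// linfty_ge0.
apply/ffunP => p; move/ffunP: Sx => /(_ p); rewrite !ffunE /grid_bit addr0.
move: (- r%:num + p.2%:R / k.+1%:R)%R => a Sx.
have := le_linfty y x p.1; rewrite ler_norml => /andP[l1 l2].
apply/idP/idP => H; first by rewrite Sx; lra.
lra.
Qed.

Lemma grid_stable_limit k x : exists2 s0 : R, (0 < s0)%R &
  forall s, (s < s0)%R -> (0 <= s)%R -> grid_stable s k x.
Proof.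
have /(_ _)/cid2-/all_sig2[d d0 dP] : forall p : 'I_N * 'I_(grid_size k),
    exists2 s0 : R, (0 < s0)%R & forall s, (s < s0)%R -> (0 <= s)%R ->
      grid_bit 0 k p.1 p.2 x = grid_bit (s + s) k p.1 p.2 x.
  move=> p; rewrite /grid_bit addr0; move: (- r%:num + p.2%:R / k.+1%:R)%R => a.
  have [H|H] := leP a (val x ord0 p.1).
    by exists 1%R => // s _ s0; apply/esym; lra.
  exists ((a - val x ord0 p.1) / 2)%R; first lra.
  by move=> s s1 s2; apply/esym/negbTE; rewrite -ltNge; lra.
pose m := \big[Num.min/1%R]_p d p.
exists m; first by apply/bigmin_gtP; split.
move=> s sm s0; apply/ffunP => p; rewrite !ffunE; apply: dP => //.
by apply: lt_le_trans sm _; exact: bigmin_le.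
Qed.

Lemma grid_stable_mono s s' k : (0 <= s)%R -> (s <= s')%R ->
  grid_stable s' k `<=` grid_stable s k.
Proof.
move=> s0 ss' x /ffunP Sx; apply/ffunP => p; have := Sx p; rewrite !ffunE /grid_bit addr0.
by move: (- r%:num + p.2%:R / k.+1%:R)%R => a H; apply/idP/idP => H'; [|rewrite H]; lra.
Qed.

(** The complements decrease to the empty set as the shift does to 0: the
    finitely many hyperplanes strictly above a point are at a positive distance
    from it. *)
Lemma grid_stable_measure (nu : probability (borel (cube N r)) R) k (e : R) :
  (0 < e)%R -> \forall n \near \oo, nu (~` grid_stable n.+1%:R^-1 k) < e%:E.
Proof.
move=> e0; pose B n : set (borel (cube N r)) := ~` grid_stable n.+1%:R^-1 k.
have mB n : measurable (B n) by apply: measurableC; exact: measurable_grid_stable.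
have B0 : \bigcap_n B n = set0.
  apply/seteqP; split => // x Bx; have [s s0 sP] := grid_stable_limit k x.
  have [n _ nP] := near_infty_natSinv_lt (PosNum s0).
  apply: (Bx n I); apply: sP; last by rewrite invr_ge0.
  exact: (nP n (leqnn n)).
have : nu \o B @ \oo --> nu (\bigcap_n B n).
  apply: nonincreasing_cvg_mu => //.
  - by rewrite (le_lt_trans (probability_le1 _ (mB 0%N)))// ltry.
  - by rewrite B0.
  - apply/nonincreasing_seqP => n; apply/subsetPset; apply: subsetC.
    by apply: grid_stable_mono => //; rewrite lef_pV2 ?posrE// ler_nat.
rewrite B0 measure0 => H.
by move/(cvge0P (fun n => measure_ge0 nu (B n))): H; exact.
Qed.

End grid.

(** * Approximation of a qm-space by its measurements *)

Section approximation.
Context (R : realType).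
Implicit Types (X : qmspace R) (r : {posnum R}).

Lemma cube_qdist_close N r (x y x' y' : cube N r) (h : R) :
  (linfty_dist x y <= h)%R -> (linfty_dist x' y' <= h)%R ->
  (`|cube_qdist x x' - cube_qdist y y'| <= h + h)%R.
Proof.
move=> xy xy'.
have := cube_qdist_triangle x y x'; have := cube_qdist_triangle y y' x'.
have := cube_qdist_triangle y x y'; have := cube_qdist_triangle x x' y'.
have := cube_qdist_le_linfty x y; have := cube_qdist_le_linfty y x.
have := cube_qdist_le_linfty x' y'; have := cube_qdist_le_linfty y' x'.
rewrite (linftyC y x) (linftyC y' x') => *.
by rewrite ler_norml; apply/andP; split; lra.
Qed.

(** Cut X along the cells of a fine grid in the cube, keeping the good points
    that are also far below the next hyperplanes, and cut the second space
    along the shifted cells.  By Prokhorov closeness each shifted cell has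
    almost at least the mass of the good points of the cell.  Matched points
    have close images in the cube, where both distances are read off. *)
Lemma box_support_class_le X N r (f : 'I_N -> X -> R)
    (mu : probability (borel (cube N r)) R) (A : set X) (e : R) :
  (forall i, Lip1 (f i)) ->
  is_pushforward (truncated_map r f : borel X -> borel (cube N r)) (qmeasure X) mu ->
  (0 < e)%R -> measurable (A : set (borel X)) -> (1 - e)%:E <= qmeasure X A ->
  (forall x x', A x -> A x' -> (qdist x x' <=
     cube_qdist (truncated_map r f x) (truncated_map r f x') + e)%R) ->
  exists2 d : R, (0 < d)%R & forall nu, near_measures d mu nu ->
    box X (support_class nu) <= (4 * e)%:E.
Proof.
move=> fL fmu e0 mA Ae dA; set u := truncated_map r f.
have mu_meas : measurable_fun setT (u : borel X -> borel (cube N r)).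
  exact: measurable_truncated_map.
have e40 : (0 < e / 4)%R by rewrite divr_gt0.
(* The mesh and the shift are at most e / 4, so matched points are e / 2 close
   in the cube and their distances differ by at most e there, hence by at most
   2 e in the two spaces; the number of cells depends on the mesh only, hence
   the shift can be chosen so small that the losses on all the cells add up to
   at most e. *)
have [k _ kP] := near_infty_natSinv_lt (PosNum e40).
have {kP}ke : (k.+1%:R^-1 < e / 4)%R := kP k (leqnn k).
pose I0 : finType := {ffun 'I_N * 'I_(grid_size r k) -> bool}.
have eI0 : (0 < e / (#|I0|.+1)%:R)%R by rewrite divr_gt0.
near \oo => n.
have de : (n.+1%:R^-1 < e / 4)%R.
  by near: n; exact: (near_infty_natSinv_lt (PosNum e40)).
have dI0 : (n.+1%:R^-1 < e / (#|I0|.+1)%:R)%R.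
  by near: n; exact: (near_infty_natSinv_lt (PosNum eI0)).
have dC : mu (~` grid_stable n.+1%:R^-1 k) < e%:E.
  by near: n; exact: grid_stable_measure.
have d0 : (0 < n.+1%:R^-1 :> R)%R by rewrite invr_gt0.
move: d0 de dI0 dC; set d : R := (n.+1%:R^-1)%R => d0 de dI0 dC.
exists d => // nu munu.
have [v [vE mv vP]] := support_class_embedding nu.
have mstable : measurable (grid_stable d k : set (borel (cube N r))).
  exact: measurable_grid_stable.
pose good : set X := A `&` u @^-1` grid_stable d k.
have mgood : measurable (good : set (borel X)).
  by apply: measurableI => //; exact: (measurable_preimageT mu_meas mstable).
(* The first component discards the bad points: [c2] is never [false] there. *)
pose c1 (x : X) : bool * I0 := (`[< good x >], grid_cell 0 k (u x)).
pose c2 (z : support_class nu) : bool * I0 := (true, grid_cell d k (v z)).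
have mu_cell (i : I0) : measurable (u @^-1` (grid_cell 0 k @^-1` [set i]) : set (borel X)).
  by apply: (measurable_preimageT mu_meas); exact: measurable_grid_cell.
have c1T (i : I0) : c1 @^-1` [set (true, i)] =
    good `&` u @^-1` (grid_cell 0 k @^-1` [set i]).
  apply/seteqP; split => x /=; rewrite /c1.
    by move=> [/asboolP gx cx].
  by move=> [gx cx]; rewrite asboolT// cx.
have c1F (i : I0) : c1 @^-1` [set (false, i)] =
    ~` good `&` u @^-1` (grid_cell 0 k @^-1` [set i]).
  apply/seteqP; split => x /=; rewrite /c1.
    by move=> [/asboolP gx cx].
  by move=> [gx cx]; rewrite asboolF// cx.
have c2T (i : I0) : c2 @^-1` [set (true, i)] =
    v @^-1` (grid_cell d k @^-1` [set i]).
  by apply/seteqP; split => x /=; rewrite /c2; [case|move=> ->].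
have c2F (i : I0) : c2 @^-1` [set (false, i)] = set0.
  by apply/seteqP; split.
have mc1 bi : measurable (c1 @^-1` [set bi] : set (borel X)).
  case: bi => -[] i; first by rewrite c1T; exact: measurableI.
  by rewrite c1F; apply: measurableI => //; exact: measurableC.
have mc2 bi : measurable (c2 @^-1` [set bi] : set (borel (support_class nu))).
  case: bi => -[] i; last by rewrite c2F; exact: measurable0.
  by rewrite c2T; apply: (measurable_preimageT mv); exact: measurable_grid_cell.
apply: (@box_le R X (support_class nu) _ c1 c2 (4 * e) (2 * e)%R) => //.
- by rewrite mulr_ge0// ltW.
- by lra.
- have le_cell (i : I0) : (fine (qmeasure X (c1 @^-1` [set (true, i)])) - d <=
      Num.min (fine (qmeasure X (c1 @^-1` [set (true, i)])))
              (fine (qmeasure (support_class nu) (c2 @^-1` [set (true, i)]))))%R.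
    rewrite le_min gerBl (ltW d0)/= lerBlDr -lee_fin EFinD.
    rewrite !fineK ?fin_num_measure// c1T c2T.
    pose D : set (borel (cube N r)) := grid_stable d k `&` grid_cell 0 k @^-1` [set i].
    have mD : measurable D by apply: measurableI => //; exact: measurable_grid_cell.
    apply: (@le_trans _ _ (mu D)).
      rewrite -fmu//; apply: le_measure; rewrite ?inE.
      - exact: measurableI.
      - exact: (measurable_preimageT mu_meas).
      - by move=> x [[_ Sx] cx].
    have [H _] := munu D mD; apply: (le_trans H); apply: leeD => //.
    have := vP _ (@measurable_grid_cell R N r d k i); rewrite /pushforward => ->.
    apply: le_measure; rewrite ?inE.
    - exact: measurable_thicken.
    - exact: measurable_grid_cell.
    - by move=> y [x [Sx <-] xy] /=; exact: grid_stable_cell.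
  pose F (p : bool * I0) := Num.min (fine (qmeasure X (c1 @^-1` [set p])))
              (fine (qmeasure (support_class nu) (c2 @^-1` [set p]))).
  have -> : (\sum_p F p = \sum_(b : bool) \sum_(i : I0) F (b, i))%R.
    by rewrite pair_bigA; apply: eq_bigr => -[].
  rewrite big_bool /= {}/F.
  have F0 : (0 <= \sum_(i : I0) Num.min (fine (qmeasure X (c1 @^-1` [set (false, i)])))
              (fine (qmeasure (support_class nu) (c2 @^-1` [set (false, i)]))))%R.
    by apply: sumr_ge0 => i _; rewrite le_min !fine_ge0.
  have T0 : (\sum_(i : I0) (fine (qmeasure X (c1 @^-1` [set (true, i)])) - d) <=
      \sum_(i : I0) Num.min (fine (qmeasure X (c1 @^-1` [set (true, i)])))
              (fine (qmeasure (support_class nu) (c2 @^-1` [set (true, i)]))))%R.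
    by apply: ler_sum => i _; exact: le_cell.
  have goodE : (\sum_(i : I0) fine (qmeasure X (c1 @^-1` [set (true, i)])) =
      fine (qmeasure X good))%R.
    apply: EFin_inj; rewrite -sumEFin fineK ?fin_num_measure//.
    rewrite (@measure_finite_map _ (borel X) R (qmeasure X) I0
      (fun x : X => grid_cell 0 k (u x) : I0) good mu_cell mgood).
    by apply: eq_bigr => i _; rewrite fineK ?fin_num_measure// c1T.
  have good_ge : (1 - 2 * e <= fine (qmeasure X good))%R.
    rewrite -lee_fin fineK ?fin_num_measure//.
    have : qmeasure X A <= qmeasure X good + mu (~` grid_stable d k).
      rewrite -fmu; last exact: measurableC.
      apply: (@le_trans _ _ (qmeasure X (good `|` u @^-1` (~` grid_stable d k)))).
        apply: le_measure; rewrite ?inE//.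
          apply: measurableU => //; apply: (measurable_preimageT mu_meas).
          exact: measurableC.
        by move=> x Ax; have [Sx|Sx] := pselect (grid_stable d k (u x)); [left|right].
      apply: measureU2 => //; apply: (measurable_preimageT mu_meas).
      exact: measurableC.
    move=> H; have : (1 - e)%:E <= qmeasure X good + e%:E.
      apply: (le_trans Ae); apply: (le_trans H); apply: leeD => //; exact: ltW.
    rewrite -leeBlDr// -EFinB; apply: le_trans; rewrite lee_fin; lra.
  have dI : (d *+ #|I0| <= e)%R.
    have c0 : (0 < (#|I0|.+1)%:R :> R)%R by [].
    have := dI0; rewrite ltr_pdivlMr// mulr_natr mulrS; lra.
  move: T0; rewrite sumrB goodE sumr_const => T0.
  by move: F0 T0 good_ge dI; set a := (d *+ _)%R; set b := (\sum_i _)%R;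
    set b' := (\sum_i _)%R; lra.
- have close x z : c1 x = c2 z -> A x /\ (linfty_dist (u x) (v z) <= e / 2)%R.
    move=> [/asboolP[Ax Sx] /ffunP cxz]; split => //.
    apply: (@le_trans _ _ (k.+1%:R^-1 + d)%R); last first.
      by apply: (@le_trans _ _ (e / 4 + e / 4)%R); [rewrite ltW// ltrD|lra].
    apply: grid_close; first exact: ltW.
    by move=> i j; have := cxz (i, j); rewrite !ffunE.
  move=> x z x' z' /close[Ax xz] /close[Ax' xz']; rewrite vE.
  have := cube_qdist_close xz xz'; have := dA _ _ Ax Ax'.
  have := truncated_map_qdist r x x' fL; rewrite -/u.
  by rewrite !ler_norml => H1 H2 /andP[H3 H4]; apply/andP; split; lra.
Unshelve. all: by end_near. Qed.

End approximation.

(** If x is in the ball of radius h around s n, then d(s n, x') - d(s n, x) is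
    within 2 h of d(x, x'); finitely many of these balls have almost full
    measure. *)
Lemma measurement_approx (R : realType) (X : qmspace R) (e : R) : (0 < e)%R ->
  exists N (r : {posnum R}) (mu : probability (borel (cube N r)) R),
    [/\ (0 < N)%N, measurement X mu & exists2 d : R, (0 < d)%R &
      forall nu, near_measures d mu nu -> box X (support_class nu) <= e%:E].
Proof.
move=> e0; have [s sP] := qm_dense_sequence X.
pose h : R := (e / 8)%R; have h0 : (0 < h)%R by rewrite divr_gt0.
pose B n : set X := [set y | (mdist (s n) y < h)%R].
pose A m : set X := \bigcup_(n < m.+1) B n.
have oB n : open (B n) by exact: open_mdist_ball.
have mA m : measurable (A m : set (borel X)).
  by apply: open_borel; apply: bigcup_open => n _.
have AT : \bigcup_m A m = setT.
  apply/seteqP; split => // x _; have [n xn] := sP x h h0.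
  by exists n => //; exists n => //=; rewrite /B/= metric_sym.
have [m Am] : exists m, (1 - e / 4)%:E <= qmeasure X (A m).
  have : (fun m => qmeasure X (A m)) @ \oo --> qmeasure X (\bigcup_m A m).
    apply: nondecreasing_cvg_mu => //; first by apply: bigcupT_measurable.
    apply/nondecreasing_seqP => m; apply/subsetPset => x [n /= nm Bx].
    by exists n => //=; rewrite ltnW.
  rewrite AT probability_setT => H.
  have : nbhs (1 : \bar R) [set x | (1 - e / 4)%:E < x].
    by apply: open_ereal_gt'; rewrite lte_fin; lra.
  move=> /H HA; have : \forall m \near \oo, (1 - e / 4)%:E < qmeasure X (A m) := HA.
  by move=> /filter_ex[m /= /ltW mP]; exists m.
pose f (i : 'I_m.+1) : X -> R := qdist (s i).
have fL i : Lip1 (f i) by exact: Lip1_qdist.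
(* D + h bounds the functions [f] on the balls, so that truncation at that
   level does not change them there. *)
pose D : R := \big[Num.max/0%R]_(p : 'I_m.+1 * 'I_m.+1) qdist (s p.1) (s p.2).
have D0 : (0 <= D)%R by exact: bigmax_ge_id.
have c0 : (0 < D + h)%R by rewrite ltr_wpDl.
pose r := PosNum c0.
have fr x i : A m x -> truncate r (f i x) = f i x.
  move=> [n /= nm Bx]; apply: truncate_id; rewrite /f.
  have q0 := qdist_ge0 (s i) x.
  apply/andP; split; first by rewrite (le_trans _ q0)// oppr_le0 ltW.
  apply: (le_trans (qdist_triangle _ (s n) _)); apply: lerD.
    exact: (@le_bigmax _ _ _ _
      (fun p : 'I_m.+1 * 'I_m.+1 => qdist (s p.1) (s p.2)) (i, Ordinal nm)).
  by rewrite (le_trans (qdist_le_mdist _ _))// ltW.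
exists m.+1, r, (@truncated_law R X _ r f fL); split => //.
  exact: measurement_truncated_law.
have e40 : (0 < e / 4)%R by rewrite divr_gt0.
have -> : e = (4 * (e / 4))%R by lra.
apply: (@box_support_class_le R X _ r f _ (A m) (e / 4)) => //.
move=> x x' Ax Ax'; have [n /= nm Bx] := Ax.
have := le_cube_qdist (truncated_map r f x) (truncated_map r f x') (Ordinal nm).
rewrite !truncated_map_coord !fr// /f /=.
have := qdist_triangle x (s n) x'; have := qdist_le_mdist (s n) x.
have := qdist_le_mdist x (s n); rewrite (metric_sym x (s n)).
by move: Bx; rewrite /B /= /h; lra.
Qed.

(** The case of [box_support_class_le] where X is itself a support space, with
    its coordinates as functions: support spaces depend continuously on the
    measure. *)
Lemma box_support_class_near (R : realType) N (r : {posnum R})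
    (mu : probability (borel (cube N r)) R) (e : R) : (0 < e)%R ->
  exists2 d : R, (0 < d)%R & forall nu, near_measures d mu nu ->
    box (support_class mu) (support_class nu) <= e%:E.
Proof.
move=> e0; have [v [vE mv vP]] := support_class_embedding mu.
pose f (i : 'I_N) (x : support_class mu) := val (v x) ord0 i.
have fL i : Lip1 (f i) by move=> x y; rewrite vE le_cube_qdist.
have fv : truncated_map r f = v.
  apply/funext => x; apply/val_inj/rowP => i.
  by rewrite truncated_map_coord truncate_id// cube_le.
have -> : e = (4 * (e / 4))%R by lra.
apply: (@box_support_class_le R _ _ r f _ setT (e / 4)) => //.
- by rewrite fv.
- by rewrite divr_gt0.
- by rewrite probability_setT lee_fin; lra.
- by move=> x x' _ _; rewrite fv vE; lra.
Qed.

(** * Compactness for the Prokhorov distance *)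

(** Two random points of the cube whose laws on matching cells almost agree and
    which are close on matching cells have Prokhorov close laws: a cell that
    meets the event A under one of them lies in the thickening of A under the
    other. *)
Lemma near_measures_partition (R : realType) N (r : {posnum R}) (I : finType)
    d1 d2 (T1 : measurableType d1) (T2 : measurableType d2)
    (P1 : probability T1 R) (P2 : probability T2 R)
    (c1 : T1 -> I) (c2 : T2 -> I) (X1 : T1 -> cube N r) (X2 : T2 -> cube N r)
    (mu1 mu2 : probability (borel (cube N r)) R) (e : R) :
  (forall i, measurable (c1 @^-1` [set i])) ->
  (forall i, measurable (c2 @^-1` [set i])) ->
  measurable_fun setT (X1 : T1 -> borel (cube N r)) ->
  measurable_fun setT (X2 : T2 -> borel (cube N r)) ->
  is_pushforward (X1 : T1 -> borel (cube N r)) P1 mu1 ->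
  is_pushforward (X2 : T2 -> borel (cube N r)) P2 mu2 ->
  (forall t1 t2, c1 t1 = c2 t2 -> (linfty_dist (X1 t1) (X2 t2) < e)%R) ->
  (forall i, `|fine (P1 (c1 @^-1` [set i])) - fine (P2 (c2 @^-1` [set i]))|
      <= e / #|I|.+1%:R)%R ->
  near_measures e mu1 mu2.
Proof.
have half d d' (T : measurableType d) (T' : measurableType d')
    (P : probability T R) (P' : probability T' R)
    (c : T -> I) (c' : T' -> I) (X : T -> cube N r) (X' : T' -> cube N r)
    (mu mu' : probability (borel (cube N r)) R) :
  (forall i, measurable (c @^-1` [set i])) ->
  (forall i, measurable (c' @^-1` [set i])) ->
  measurable_fun setT (X : T -> borel (cube N r)) ->
  measurable_fun setT (X' : T' -> borel (cube N r)) ->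
  is_pushforward (X : T -> borel (cube N r)) P mu ->
  is_pushforward (X' : T' -> borel (cube N r)) P' mu' ->
  (forall t t', c t = c' t' -> (linfty_dist (X t) (X' t') < e)%R) ->
  (forall i, `|fine (P (c @^-1` [set i])) - fine (P' (c' @^-1` [set i]))|
      <= e / #|I|.+1%:R)%R ->
  forall A : set (borel (cube N r)), measurable A ->
    mu A <= mu' (thicken e A) + e%:E.
  move=> mc mc' mX mX' PX PX' close cell A mA.
  have mXA : measurable (X @^-1` A) by exact: (measurable_preimageT mX mA).
  have mXA' : measurable (X' @^-1` thicken e A).
    exact: (measurable_preimageT mX' (measurable_thicken e A)).
  rewrite -PX// -PX'; last exact: measurable_thicken.
  rewrite /pushforward (measure_finite_map P mc mXA) (measure_finite_map P' mc' mXA').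
  have e0 : (0 <= e)%R.
    have := probability_setT P; have [t _ |T0] := pselect (exists t : T, True); last first.
      rewrite (_ : setT = set0) ?measure0; last by apply/seteqP; split => // t; case: T0; exists t.
      by move=> /eqP; rewrite eq_sym onee_eq0.
    have [i _] : exists i : I, True by case: t => t _; exists (c t).
    by have := le_trans (normr_ge0 _) (cell i); rewrite pmulr_lge0.
  apply: (@le_trans _ _ (\sum_i (P' (X' @^-1` thicken e A `&` c' @^-1` [set i]) +
      (e / #|I|.+1%:R)%:E))).
    apply: lee_sum => i _.
    have [[t [XAt cti]]|noA] := pselect (exists t, A (X t) /\ c t = i); last first.
      rewrite (_ : _ `&` _ = set0) ?measure0.
        by rewrite adde_ge0// lee_fin divr_ge0.
      by apply/seteqP; split => // t [? ?]; case: noA; exists t.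
    rewrite (_ : X' @^-1` thicken e A `&` c' @^-1` [set i] = c' @^-1` [set i]); last first.
      apply/seteqP; split => [t' []//|t' c't'] ; split => //=.
      by exists (X t) => //; rewrite linftyC; apply: close; rewrite cti c't'.
    apply: (@le_trans _ _ (P (c @^-1` [set i]))).
      by apply: le_measure; rewrite ?inE//; exact: measurableI.
    rewrite -(@fineK _ (P _)) ?fin_num_measure// -(@fineK _ (P' _)) ?fin_num_measure//.
    rewrite -EFinD lee_fin; have := cell i; rewrite ler_norml => /andP[_].
    by move: (e / _)%R => q; lra.
  rewrite big_split/=; apply: leeD => //; rewrite sumEFin lee_fin sumr_const.
  rewrite -(mulr_natr (e / _)%R) mulrAC ler_pdivrMr// ler_wpM2l// ler_nat.
  by apply: leq_trans (max_card _) _; rewrite ?cardT.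
move=> mc1 mc2 mX1 mX2 PX1 PX2 close cell A mA; split.
  exact: (half _ _ _ _ _ _ _ _ _ _ _ _ mc1 mc2 mX1 mX2 PX1 PX2 close cell).
apply: (half _ _ _ _ _ _ _ _ _ _ _ _ mc2 mc1 mX2 mX1 PX2 PX1) => //.
  by move=> t t' tt'; rewrite linftyC; exact: close.
by move=> i; rewrite distrC.
Qed.

(** A consistent system of weights on the binary tree is realised by the nested
    subdivisions of [0, 1) that it prescribes: the vertex s gets the interval
    with left end [left_end s] and length w s. *)
Section binary_tree.
Context (R : realType) (w : seq bool -> R).
Hypothesis w_ge0 : forall s, (0 <= w s)%R.
Hypothesis w_nil : w [::] = 1%R.
Hypothesis w_rcons : forall s, w s = (w (rcons s false) + w (rcons s true))%R.

Definition left_end (s : seq bool) : R :=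
  (\sum_(i < size s) if nth false s i then w (rcons (take i s) false) else 0)%R.

Lemma left_end_rcons s b : left_end (rcons s b) =
  (left_end s + (if b then w (rcons s false) else 0))%R.
Proof.
rewrite /left_end size_rcons big_ord_recr /=; congr (_ + _)%R; last first.
  by rewrite nth_rcons ltnn eqxx -[in take _ _]cats1 take_size_cat.
apply: eq_bigr => i _; rewrite nth_rcons ltn_ord.
by rewrite -[in take _ _]cats1 takel_cat// ltnW.
Qed.

(** The vertex at depth [k] whose interval contains [t]. *)
Fixpoint walk (k : nat) (t : R) : seq bool :=
  if k is k'.+1 then
    let s := walk k' t in rcons s (left_end s + w (rcons s false) <= t)%R
  else [::].

Lemma size_walk k t : size (walk k t) = k.
Proof. by elim: k => //= k IH; rewrite size_rcons IH. Qed.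

Lemma take_walk k l t : (k <= l)%N -> take k (walk l t) = walk k t.
Proof.
elim: l => [|l IH]; first by rewrite leqn0 => /eqP ->.
rewrite leq_eqVlt => /orP[/eqP ->|kl]; first by rewrite take_oversize// size_walk.
by rewrite /= -cats1 takel_cat ?size_walk// IH.
Qed.

Lemma walkP s t : (0 <= t < 1)%R ->
  walk (size s) t = s <-> (left_end s <= t < left_end s + w s)%R.
Proof.
move=> t01; elim/last_ind: s => [|s b IH].
  by rewrite /left_end /= big_ord0 add0r w_nil.
rewrite size_rcons left_end_rcons /=; have ws := w_rcons s.
have w0 := w_ge0 (rcons s false); have w1 := w_ge0 (rcons s true).
split=> [/rcons_inj[Es Eb]|H].
  move/IH: (Es) => /andP[ls us]; rewrite Es in Eb.
  by move: Eb; case: b => /=; [move=> Eb|move=> /negbT; rewrite -ltNge => Eb];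
    apply/andP; split; lra.
have Es : walk (size s) t = s.
  by apply/IH; move: H; case: b => /= /andP[? ?]; apply/andP; split; lra.
rewrite Es; congr rcons; move: H; case: b => /= /andP[? ?]; first lra.
by apply/negbTE; rewrite -ltNge; lra.
Qed.

Lemma left_end_bounds s : (0 <= left_end s)%R /\ (left_end s + w s <= 1)%R.
Proof.
elim/last_ind: s => [|s b [l0 u1]].
  by rewrite /left_end big_ord0 w_nil add0r.
rewrite left_end_rcons; have ws := w_rcons s.
have w0 := w_ge0 (rcons s false); have w1 := w_ge0 (rcons s true).
by case: b; split; lra.
Qed.

(** Makes the walk follow a branch of positive weights at every real number,
    and not only on [0, 1), so that no exceptional set has to be carried. *)
Definition clamp01 (t : R) : R := if (0 <= t < 1)%R then t else 0%R.

Lemma clamp01_bounds t : (0 <= clamp01 t < 1)%R.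
Proof. by rewrite /clamp01; case: ifPn => // _; rewrite lexx ltr01. Qed.

Lemma walk_w_gt0 k t : (0 < w (walk k (clamp01 t)))%R.
Proof.
have [H _] := @walkP (walk k (clamp01 t)) _ (clamp01_bounds t).
by move: H; rewrite size_walk => /(_ erefl)/andP[]; lra.
Qed.

Lemma measurable_walk s : measurable ([set t : R | walk (size s) (clamp01 t) = s]).
Proof.
rewrite (_ : mkset _ = `[0%R, 1%R[ `&` `[left_end s, (left_end s + w s)%R[ `|`
   (if walk (size s) 0%R == s then ~` `[0%R, 1%R[ else set0)); last first.
  apply/seteqP; split => t /=; rewrite /clamp01 !in_itv/=; have [t01|t01] := boolP (0 <= t < 1)%R.
  - by move=> /(@walkP s t t01) H; left.
  - by move=> ->; right; rewrite eqxx /= in_itv/=; exact/negP.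
  - move=> [[_ /(@walkP s t t01)]|] //.
    by case: ifP => // _ /=; rewrite in_itv/= t01.
  - by move=> [[]//|]; case: ifP => // /eqP.
apply: measurableU; first exact: measurableI.
by case: ifP => _ //; apply: measurableC.
Qed.

Lemma binary_tree_measure : exists P : probability (measurableTypeR R) R,
  forall s, P [set t | walk (size s) (clamp01 t) = s] = (w s)%:E.
Proof.
have m01 : measurable (`[0%R, 1%R[ : set (measurableTypeR R)) by [].
have [|P PE] := @probability_of_measure _ (measurableTypeR R) R
  (mrestr (@lebesgue_measure R) m01).
  apply: (@etrans _ _ (@lebesgue_measure R ([set: R] `&` `[0%R, 1%R[))) => //.
  by rewrite setTI lebesgue_measure_itv/= lte_fin ltr01 oppr0 adde0.
exists P => s; rewrite PE.
apply: (@etrans _ _ (@lebesgue_measure R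
  ([set t | walk (size s) (clamp01 t) = s] `&` `[0%R, 1%R[))) => //.
rewrite (_ : _ `&` _ = [set` `[left_end s, (left_end s + w s)%R[]); last first.
  have [l0 u1] := left_end_bounds s.
  apply/seteqP; split => t /=; rewrite !in_itv/=.
    by move=> [+ t01]; rewrite /clamp01 t01 => /(@walkP s t t01).
  move=> H; have t01 : (0 <= t < 1)%R by move/andP: H => [? ?]; apply/andP; split; lra.
  by split => //; rewrite /clamp01 t01; apply/walkP.
rewrite lebesgue_measure_itv/= lte_fin ltrDl; case: ifPn => [_|].
  by rewrite -EFinB addrAC subrr add0r.
by rewrite -leNgt => w0; congr EFin; apply/eqP; rewrite eq_le w_ge0 w0.
Qed.

End binary_tree.

Section words.
Context (R : realType) (N : nat) (r : {posnum R}).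
Implicit Types (x y : cube N r) (m : nat) (s : seq bool).

(** All the hyperplanes of all the grids, enumerated; the first [m] digits of a
    point determine a cell, and these cells are nested. *)
Definition digit m x : bool :=
  if @unpickle ('I_N * nat * nat)%type m is Some ikj
  then grid_bit 0 ikj.1.2 ikj.1.1 ikj.2 x else false.

Definition word m x : seq bool := mkseq (digit^~ x) m.

Lemma size_word m x : size (word m x) = m.
Proof. exact: size_mkseq. Qed.

Lemma take_word k m x : (k <= m)%N -> take k (word m x) = word k x.
Proof. by move=> km; rewrite /word /mkseq -map_take take_iota (minn_idPl km). Qed.

Lemma measurable_digit m b : measurable ([set x | digit m x = b] : set (borel (cube N r))).
Proof.
rewrite /digit; case: unpickle => [ikj|]; first exact: measurable_grid_bit.
case: b; last first.
  by rewrite (_ : mkset _ = setT)//; apply/seteqP; split.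
by rewrite (_ : mkset _ = set0)//; apply/seteqP; split.
Qed.

Lemma measurable_word s :
  measurable ([set x | word (size s) x = s] : set (borel (cube N r))).
Proof.
rewrite (_ : mkset _ = [set x | forall i : 'I_(size s), digit i x = nth false s i]).
  by apply: measurable_forall_fin => i; exact: measurable_digit.
apply/seteqP; split => x /=.
  by move=> sE i; have := congr1 (nth false ^~ i) sE; rewrite nth_mkseq.
move=> H; apply: (@eq_from_nth _ false); first exact: size_word.
by move=> i; rewrite size_word => si; rewrite nth_mkseq// (H (Ordinal si)).
Qed.

Lemma word_close (e : R) : (0 < e)%R ->
  exists m, forall x y, word m x = word m y -> (linfty_dist x y <= e)%R.
Proof.
move=> e0; have [k _ kP] := near_infty_natSinv_lt (PosNum e0).
have {kP}ke : (k.+1%:R^-1 < e)%R := kP k (leqnn k).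
pose code (p : 'I_N * 'I_(grid_size r k)) := pickle (p.1, k, nat_of_ord p.2).
exists (\max_p code p).+1 => x y xy; apply: le_trans (ltW ke).
rewrite -[leRHS]addr0; apply: grid_close => // i j.
have lt_code : (code (i, j) < (\max_p code p).+1)%N by rewrite ltnS leq_bigmax.
have := congr1 (fun s => nth false s (code (i, j))) xy.
by rewrite !nth_mkseq// /digit /code !pickleK.
Qed.

End words.

Lemma ultra_map (S T : Type) (f : S -> T) (F : set_system S) :
  UltraFilter F -> UltraFilter (fmap f F).
Proof.
move=> FU; split; first exact: fmap_proper_filter.
move=> G GF FG; apply/seteqP; split => A; last exact: FG.
move=> GA; have [//|FnA] := in_ultra_setVsetC (f @^-1` A) FU.
have : G (A `&` ~` A) by apply: filterI => //; exact: FG.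
by move=> /filter_ex[? []].
Qed.

(** The weights [w] are the limits along [U] of the masses of the cells.  The
    walk at [t] selects a nested sequence of cells, nonempty because their
    weights are positive; [approx k t] is a point of the k-th one and [T t] is
    the limit of these points.  Cells are not closed, so [T t] may leave them,
    but it stays at a distance that is controlled by their size. *)
Section compactness.
Context (R : realType) (N : nat) (r : {posnum R}).
Variables (U : set_system nat) (nu : nat -> probability (borel (cube N r)) R).
Hypothesis UU : UltraFilter U.

Let a n (s : seq bool) : R := fine (nu n [set x | word (size s) x = s]).

Let aE n s : nu n [set x | word (size s) x = s] = (a n s)%:E.
Proof. by rewrite /a fineK// fin_num_measure//; exact: measurable_word. Qed.

Let a_lim s : exists2 l : R, (0 <= l)%R & a ^~ s @ U --> l.
Proof.
have := @segment_compact R 0 1; rewrite compact_ultra => /(_ (a ^~ s @ U)).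
have a01 : (a ^~ s @ U) [set` `[0%R, 1%R]].
  have : \forall n \near U, a n s \in `[0%R, 1%R]; last by [].
  apply: nearW => n /=; rewrite in_itv /= -!lee_fin -aE measure_ge0/=.
  exact: (probability_le1 (nu n) (measurable_word s)).
by move=> /(_ (ultra_map (a ^~ s) UU) a01)[l [/=]]; rewrite in_itv/= => /andP[l0 _] al; exists l.
Qed.

Let w s : R := projT1 (cid2 (a_lim s)).

Let w_ge0 s : (0 <= w s)%R. Proof. by rewrite /w; case: cid2. Qed.
Let w_lim s : a ^~ s @ U --> w s. Proof. by rewrite /w; case: cid2. Qed.

Let w_unique s (l : R) : a ^~ s @ U --> l -> w s = l.
Proof. move=> al; rewrite -(cvg_lim (@Rhausdorff R) (@w_lim s)).
exact: (cvg_lim (@Rhausdorff R) al). Qed.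

Let w_nil : w [::] = 1%R.
Proof.
apply: w_unique; rewrite (_ : a ^~ [::] = cst 1%R); first exact: cvg_cst.
apply/funext => n; rewrite /a (_ : mkset _ = setT) ?probability_setT//.
by apply/seteqP; split.
Qed.

Let w_rcons s : w s = (w (rcons s false) + w (rcons s true))%R.
Proof.
apply: w_unique.
rewrite (_ : a ^~ s = fun n => (a n (rcons s false) + a n (rcons s true))%R).
  by apply: cvgD; exact: w_lim.
apply/funext => n; apply: EFin_inj; rewrite EFinD -!aE.
rewrite (measure_finite_map (nu n) (@measurable_digit R N r (size s)) (measurable_word s)).
rewrite big_bool /= addeC; congr (_ + _); congr (nu n _);
  apply/seteqP; split => x /=; rewrite size_rcons /word mkseqS.
- by move=> [-> ->].
- by move=> /rcons_inj[-> ->].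
- by move=> [-> ->].
- by move=> /rcons_inj[-> ->].
Qed.

Let pt s : cube N r :=
  if pselect (exists x, word (size s) x = s) is left h then projT1 (cid h) else point.

Let word_pt s : (0 < w s)%R -> word (size s) (pt s) = s.
Proof.
move=> ws; have : \forall n \near U, (0 < a n s)%R.
  by move/cvgr_gt : (@w_lim s); exact.
move=> /filter_ex[n an]; rewrite /pt.
case: pselect => [h|no]; first by case: cid.
move: an; rewrite /a (_ : mkset _ = set0) ?measure0 ?ltxx//.
by apply/seteqP; split => // x xs; apply: no; exists x.
Qed.

Let approx k t : cube N r := pt (walk w k (clamp01 t)).

Let word_approx k t : word k (approx k t) = walk w k (clamp01 t).
Proof.
have := word_pt (walk_w_gt0 w_ge0 w_nil w_rcons k t).
by rewrite size_walk.
Qed.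

Let word_approx_le m k t : (m <= k)%N -> word m (approx k t) = word m (approx m t).
Proof.
by move=> mk; rewrite -(take_word _ mk) !word_approx take_walk.
Qed.

Let approx_lim t : exists x, forall e : R, (0 < e)%R ->
  \forall k \near \oo, (linfty_dist (approx k t) x < e)%R.
Proof.
have [e e0|x xP] := @cube_complete R N r (approx ^~ t @ \oo) _; last by exists x.
have e20 : (0 < e / 2)%R by rewrite divr_gt0.
have [m mP] := @word_close R N r _ e20.
exists (approx m t); exists m => // k /= mk.
rewrite (@le_lt_trans _ _ (e / 2)%R)//; last lra.
by apply: mP; exact: word_approx_le.
Qed.

Let T t : cube N r := projT1 (cid (approx_lim t)).

Let T_lim t (e : R) : (0 < e)%R ->
  \forall k \near \oo, (linfty_dist (approx k t) (T t) < e)%R.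
Proof. by rewrite /T; case: cid => x /=; exact. Qed.

Let measurable_approx k (B : set (cube N r)) :
  measurable (approx k @^-1` B : set (measurableTypeR R)).
Proof.
rewrite (_ : _ @^-1` _ = \bigcup_(s in [set: k.-tuple bool])
    (if `[< B (pt s) >] then [set t | walk w (size s) (clamp01 t) = s] else set0)).
  apply: fin_bigcup_measurable => // s _; case: asboolP => _ //.
  exact: measurable_walk.
apply/seteqP; split => t /=.
  move=> Bt; have Hs : size (walk w k (clamp01 t)) == k by rewrite size_walk.
  by exists (Tuple Hs) => //=; rewrite asboolT//= size_walk.
move=> [s _]; case: asboolP => // Bs /=; rewrite size_tuple => ws.
by rewrite /approx ws.
Qed.

(* [T t] is in the open set V if and only if, for some radius, the ball around
   [approx k t] is in V for all large k. *)
Let measurable_T : measurable_fun setT (T : measurableTypeR R -> borel (cube N r)).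
Proof.
apply: measurable_to_borel => V oV.
pose Vj j : set (cube N r) :=
  [set x | [set y | (linfty_dist y x < j.+1%:R^-1)%R] `<=` V].
rewrite (_ : _ @^-1` _ = \bigcup_j \bigcup_K \bigcap_k (approx (K + k) @^-1` Vj j)).
  apply: bigcupT_measurable => j; apply: bigcupT_measurable => K.
  by apply: bigcapT_measurable => k; exact: measurable_approx.
apply/seteqP; split => t /=.
  move=> VT; have [e e0 eV] := nbhs_linfty (open_nbhs_nbhs (conj oV VT)).
  have e20 : (0 < e / 2)%R by rewrite divr_gt0.
  have [j _ jP] := near_infty_natSinv_lt (PosNum e20).
  have {jP}je : (j.+1%:R^-1 < e / 2)%R := jP j (leqnn j).
  have [K _ KP] := T_lim t e20.
  exists j => //; exists K => // k _ y /= yk; apply: eV => /=.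
  have := KP (K + k)%N (leq_addr _ _); have := linfty_triangle (approx (K + k) t) y (T t).
  by move: yk je => /=; move: (j.+1%:R^-1)%R => h; lra.
move=> [j _ [K _ KP]].
have j0 : (0 < j.+1%:R^-1 :> R)%R by rewrite invr_gt0.
have [K' _ K'P] := T_lim t j0.
have := KP K' I; apply => /=; rewrite linftyC.
by apply: K'P => /=; rewrite leq_addl.
Qed.

Lemma ultra_prokhorov_limit : exists mu : probability (borel (cube N r)) R,
  forall e : R, (0 < e)%R -> \forall n \near U, near_measures e (nu n) mu.
Proof.
have [P PE] := binary_tree_measure w_ge0 w_nil w_rcons.
exists (image_law P measurable_T) => e e0.
have e30 : (0 < e / 3)%R by rewrite divr_gt0.
have [m mP] := @word_close R N r _ e30.
pose S : finType := (m.-tuple bool)%type.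
have eS : (0 < e / #|S|.+1%:R)%R by rewrite divr_gt0.
have : \forall n \near U, forall s : S, (`|w s - a n s| < e / #|S|.+1%:R)%R.
  by apply: filter_forall => s; move/cvgrPdist_lt : (@w_lim s); exact.
apply: filterS => n close_n.
have sw (x : cube N r) : size (word m x) == m by rewrite size_word.
have st t : size (walk w m (clamp01 t)) == m by rewrite size_walk.
pose c1 (x : cube N r) : S := Tuple (sw x); pose c2 t : S := Tuple (st t).
have c1E s : c1 @^-1` [set s] = [set x | word (size s) x = s].
  apply/seteqP; split => x /=; first by move=> <-; rewrite /= size_word.
  by rewrite size_tuple => xs; exact/val_inj.
have c2E s : c2 @^-1` [set s] = [set t | walk w (size s) (clamp01 t) = s].
  apply/seteqP; split => t /=; first by move=> <-; rewrite /= size_walk.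
  by rewrite size_tuple => xs; exact/val_inj.
apply: (@near_measures_partition R N r S _ _ (borel (cube N r)) (measurableTypeR R)
  (nu n) P c1 c2 id T) => //.
- by move=> s; rewrite c1E; exact: measurable_word.
- by move=> s; rewrite c2E; exact: measurable_walk.
- move=> x t c12; have xt : word m x = word m (approx m t).
    by rewrite word_approx; exact: (congr1 val c12).
  have [K _ KP] := T_lim t e30.
  have := KP (maxn K m) (leq_maxl _ _); have := mP _ _ xt.
  have := mP _ _ (esym (word_approx_le t (leq_maxr K m))).
  have := linfty_triangle (approx m t) x (T t).
  have := linfty_triangle (approx (maxn K m) t) (approx m t) (T t).
  by rewrite /=; lra.
- by move=> s; rewrite c1E c2E PE /= ltW// distrC; exact: close_n.
Qed.

End compactness.

(** * Stability of measurements *)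

(** The easy half of the comparison of couplings with the Prokhorov distance. *)
Lemma near_measures_coupled (R : realType) N (r : {posnum R}) d
    (T : measurableType d) (P : probability T R) (X1 X2 : T -> cube N r)
    (mu1 mu2 : probability (borel (cube N r)) R) (S : set T) (e : R) :
  measurable_fun setT (X1 : T -> borel (cube N r)) ->
  measurable_fun setT (X2 : T -> borel (cube N r)) ->
  is_pushforward (X1 : T -> borel (cube N r)) P mu1 ->
  is_pushforward (X2 : T -> borel (cube N r)) P mu2 ->
  measurable S -> P (~` S) <= e%:E ->
  (forall t, S t -> (linfty_dist (X1 t) (X2 t) < e)%R) ->
  near_measures e mu1 mu2.
Proof.
have half (X X' : T -> cube N r) (mu mu' : probability (borel (cube N r)) R) :
  measurable_fun setT (X : T -> borel (cube N r)) ->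
  measurable_fun setT (X' : T -> borel (cube N r)) ->
  is_pushforward (X : T -> borel (cube N r)) P mu ->
  is_pushforward (X' : T -> borel (cube N r)) P mu' ->
  measurable S -> P (~` S) <= e%:E ->
  (forall t, S t -> (linfty_dist (X t) (X' t) < e)%R) ->
  forall A : set (borel (cube N r)), measurable A ->
    mu A <= mu' (thicken e A) + e%:E.
  move=> mX mX' PX PX' mS Se close A mA; rewrite -PX// -PX'; last exact: measurable_thicken.
  have mXA := measurable_preimageT mX mA.
  have mXA' := measurable_preimageT mX' (measurable_thicken e A).
  have mSC : measurable (~` S) by exact: measurableC.
  rewrite /pushforward.
  apply: (@le_trans _ _ (P (X' @^-1` thicken e A `|` ~` S))).
    apply: le_measure; rewrite ?inE//; first exact: measurableU.
    move=> t At; have [St|St] := pselect (S t); [left|by right].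
    by exists (X t) => //; rewrite linftyC; exact: close.
  by apply: le_trans (measureU2 _ mXA' mSC) _; exact: leeD.
move=> mX1 mX2 PX1 PX2 mS Se close A mA; split; first exact: (half X1 X2).
by apply: (half X2 X1) => // t St; rewrite linftyC; exact: close.
Qed.

Lemma measurable_lipschitz_cube (R : realType) N M (r r' : {posnum R})
    (p : cube M r' -> cube N r) :
  (forall x y, (linfty_dist (p x) (p y) <= linfty_dist x y)%R) ->
  measurable_fun setT (p : borel (cube M r') -> borel (cube N r)).
Proof.
move=> plip; apply: continuous_borel => x U /nbhs_linfty[e e0 eU].
apply: (@filterS _ _ _ [set y | (linfty_dist y x < e)%R]).
  by move=> y /= yx; apply: eU; exact: le_lt_trans (plip _ _) yx.
by apply: open_nbhs_nbhs; split; [exact: open_linfty_ball|rewrite /= linftyxx].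
Qed.

Lemma near_measures_lipschitz (R : realType) N M (r r' : {posnum R})
    (p : cube M r' -> cube N r) (mu1 mu2 : probability (borel (cube M r')) R)
    (nu1 nu2 : probability (borel (cube N r)) R) (e : R) :
  (forall x y, (linfty_dist (p x) (p y) <= linfty_dist x y)%R) ->
  is_pushforward (p : borel (cube M r') -> borel (cube N r)) mu1 nu1 ->
  is_pushforward (p : borel (cube M r') -> borel (cube N r)) mu2 nu2 ->
  near_measures e mu1 mu2 -> near_measures e nu1 nu2.
Proof.
move=> plip P1 P2 near12.
have mp : measurable_fun setT (p : borel (cube M r') -> borel (cube N r)).
  exact: measurable_lipschitz_cube.
have half (mu mu' : probability (borel (cube M r')) R)
    (nu nu' : probability (borel (cube N r)) R) (A : set (borel (cube N r))) :
    is_pushforward (p : borel (cube M r') -> borel (cube N r)) mu nu ->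
    is_pushforward (p : borel (cube M r') -> borel (cube N r)) mu' nu' ->
    measurable A -> near_measures e mu mu' -> nu A <= nu' (thicken e A) + e%:E.
  move=> Pmu Pmu' mA near; have [H _] := near _ (measurable_preimageT mp mA).
  rewrite -Pmu// -Pmu'; last exact: measurable_thicken.
  apply: (le_trans H); apply: leeD => //; apply: le_measure; rewrite ?inE.
  - exact: measurable_thicken.
  - exact: (measurable_preimageT mp (measurable_thicken e A)).
  - by move=> x [y Apy xy]; exists (p y) => //; exact: le_lt_trans (plip _ _) xy.
move=> A mA; split; first exact: (half mu1 mu2).
by apply: (half mu2 mu1) => //; exact: near_measuresC.
Qed.

(** On the set S of an almost optimal coupling, functions of Lip1 X are e-close
    to functions of Lip1 Y; hence so are the truncated tuples, off an event of
    probability at most e.  The bound on [e] excludes the empty S, for which the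
    Hausdorff term of the box distance vanishes by convention. *)
Lemma measurement_box (R : realType) (X Y : qmspace R) N (r : {posnum R})
    (mu : probability (borel (cube N r)) R) (e : R) :
  (e <= 1)%R -> box X Y < e%:E -> measurement X mu ->
  exists2 nu, measurement Y nu & near_measures e mu nu.
Proof.
move=> e1 /ereal_inf_lt[_ [pi [S [[pi1 pi2] cS ->]]]].
rewrite gt_max => /andP[piS sh] [f [fL fmu]].
have mS : measurable (S : set (borel (X * Y)%type)) by exact: closed_borel.
have S0 : S <> set0.
  by move=> S0; move: piS; rewrite S0 measure0 sube0 lte_fin ltNge e1.
have e0 : (0 < e)%R.
  rewrite -lte_fin; apply: le_lt_trans piS; rewrite sube_ge0 ?probability_le1//.
  by rewrite fin_num_measure.
have {}sh : hausdorff (sup_dist S) [set f \o fst | f in @Lip1 R X]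
    [set g \o snd | g in @Lip1 R Y] < e%:E.
  rewrite ltNge; apply/negP => H; move: sh; rewrite /sup_hausdorff asboolF//.
  rewrite ltNge => /negP; apply; apply: (@le_trans _ _ (2%:E * e%:E)).
    by rewrite -EFinM lee_fin; lra.
  exact: lee_wpmul2l.
have [/(_ _ _)/cid2 H _] := hausdorff_lt sh.
have /all_sig2[g gL fg] : forall i, {g : Y -> R | Lip1 g &
    forall z : X * Y, S z -> (`|f i z.1 - g z.2| < e)%R}.
  move=> i; have [_ /cid2[g gL <-] fge] := H (f i \o fst) (ltac:(by exists (f i))).
  exists g => // z Sz; rewrite -lte_fin; apply: le_lt_trans fge.
  by apply: ereal_sup_ubound; exists z.
exists (@truncated_law R Y N r g gL); first exact: measurement_truncated_law.
have mfst : measurable_fun setT (fst : borel (X * Y)%type -> borel X).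
  by apply: (@continuous_borel (X * Y)%type X) => z; exact: cvg_fst.
have msnd : measurable_fun setT (snd : borel (X * Y)%type -> borel Y).
  by apply: (@continuous_borel (X * Y)%type Y) => z; exact: cvg_snd.
have mf := @measurable_truncated_map R X N r f fL.
have mg := @measurable_truncated_map R Y N r g gL.
apply: (@near_measures_coupled R N r _ (borel (X * Y)%type) pi
  (truncated_map r f \o fst) (truncated_map r g \o snd) _ _ S).
- exact: measurableT_comp mf mfst.
- exact: measurableT_comp mg msnd.
- exact: is_pushforward_comp mf pi1 fmu.
- exact: (is_pushforward_comp mg pi2).
- exact: mS.
- by rewrite probability_setC// ltW.
- move=> z Sz; apply/linfty_ltP => // i; rewrite !truncated_map_coord.
  exact: le_lt_trans (truncate_dist_le _ _ _) (fg _ _ Sz).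
Qed.

Section projection.
Context (R : realType) (N M : nat) (r r' : {posnum R}).
Hypothesis NM : (N <= M)%N.
Hypothesis rr' : (r%:num <= r'%:num)%R.

(** Forgets the last coordinates and truncates the others further. *)
Definition cube_proj (x : cube M r') : cube N r :=
  exist (fun v => v \in @cube_set R N r) _
    (truncate_cube r (fun i => val x ord0 (widen_ord NM i))).

Lemma cube_proj_lipschitz x y :
  (linfty_dist (cube_proj x) (cube_proj y) <= linfty_dist x y)%R.
Proof.
apply/linfty_leP => [|i]; first exact: linfty_ge0.
rewrite /cube_proj /= !mxE; apply: le_trans (truncate_dist_le _ _ _) _.
exact: le_linfty.
Qed.

Lemma cube_proj_truncated_map (X : qmspace R) (g : 'I_M -> X -> R) x :
  cube_proj (truncated_map r' g x) = truncated_map r (fun i => g (widen_ord NM i)) x.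
Proof.
apply/val_inj/rowP => i; rewrite truncated_map_coord /cube_proj /= mxE.
by rewrite truncated_map_coord truncate_truncate.
Qed.

(** A measurement in the small cube is the projection of a measurement in the
    large one, obtained by completing the tuple of functions with constants. *)
Lemma pyramid_measurement_project (P Q : pyramid R) (e : R) :
  (forall mu, pyramid_measurement P M r' mu ->
     exists2 nu, pyramid_measurement Q M r' nu & near_measures e mu nu) ->
  forall mu, pyramid_measurement P N r mu ->
     exists2 nu, pyramid_measurement Q N r nu & near_measures e mu nu.
Proof.
move=> H mu [X [PX [f [fL fmu]]]].
pose f' (j : 'I_M) : X -> R := if insub (nat_of_ord j) is Some i then f i else fun=> 0%R.
have f'L j : Lip1 (f' j).
  by rewrite /f'; case: insubP => [i _ _|_]; [exact: fL|exact: Lip1_cst].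
have f'E i : f' (widen_ord NM i) = f i.
  by rewrite /f' /=; case: insubP => [i' _ /val_inj ->//|]; rewrite ltn_ord.
have [nu' [Y [QY [g [gL gnu]]]] near] := H (@truncated_law R X M r' f' f'L)
  (ex_intro _ X (conj PX (@measurement_truncated_law R X M r' f' f'L))).
have gL' (i : 'I_N) : Lip1 (g (widen_ord NM i)) by exact: gL.
exists (@truncated_law R Y N r _ gL').
  by exists Y; split => //; exact: measurement_truncated_law.
apply: (near_measures_lipschitz cube_proj_lipschitz _ _ near).
  move=> B mB; rewrite -fmu//; congr (qmeasure X _).
  have f'W : (fun i => f' (widen_ord NM i)) = f by apply/funext.
  by apply/seteqP; split => x /=; rewrite cube_proj_truncated_map f'W.
move=> B mB.
have mproj : measurable_fun setT (cube_proj : borel (cube M r') -> borel (cube N r)).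
  exact: measurable_lipschitz_cube cube_proj_lipschitz.
rewrite /pushforward -gnu; last exact: (measurable_preimageT mproj mB).
congr (qmeasure Y _).
by apply/seteqP; split => y /=; rewrite cube_proj_truncated_map.
Qed.

End projection.

(** * Pyramids and the metric given by measurements *)

Section pyramid_hausdorff.
Context (R : realType).
Implicit Types (P Q : pyramid R) (N : nat) (r : {posnum R}) (e : R).

Definition hausdorff_measurement N r P Q : \bar R :=
  hausdorff (@prokhorov R N r) (pyramid_measurement P N r) (pyramid_measurement Q N r).

Lemma pyramid_measurement_nonempty P N r : pyramid_measurement P N r !=set0.
Proof.
have [X PX] := pyramid_nonempty P.
exists (@truncated_law R X N r (fun=> fun=> 0%R) (fun=> @Lip1_cst R X 0%R)), X.
by split => //; exact: measurement_truncated_law.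
Qed.

Lemma hausdorff_measurement_lt N r P Q e : hausdorff_measurement N r P Q < e%:E ->
  (forall mu, pyramid_measurement P N r mu ->
     exists2 nu, pyramid_measurement Q N r nu & near_measures e mu nu) /\
  (forall nu, pyramid_measurement Q N r nu ->
     exists2 mu, pyramid_measurement P N r mu & near_measures e nu mu).
Proof.
move=> /hausdorff_lt[PQ QP]; split => mu /[dup] _.
  by move=> /PQ[nu Qnu /prokhorov_lt]; exists nu.
by move=> /QP[nu Pnu /prokhorov_lt/near_measuresC]; exists nu.
Qed.

Lemma hausdorff_measurement_le N r P Q e : (0 < e)%R ->
  (forall mu, pyramid_measurement P N r mu ->
     exists2 nu, pyramid_measurement Q N r nu & near_measures e mu nu) ->
  (forall nu, pyramid_measurement Q N r nu ->
     exists2 mu, pyramid_measurement P N r mu & near_measures e nu mu) ->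
  hausdorff_measurement N r P Q <= e%:E.
Proof.
move=> e0 PQ QP; apply: hausdorff_le => [mu /PQ[nu Qnu near]|nu /QP[mu Pmu near]].
  by exists nu => //; exact: prokhorov_le.
by exists mu => //; apply: prokhorov_le => //; exact: near_measuresC.
Qed.

Lemma hausdorff_measurement_ge0 N r P Q : 0 <= hausdorff_measurement N r P Q.
Proof.
apply: hausdorff_ge0; [exact: prokhorov_ge0|exact: pyramid_measurement_nonempty].
Qed.

Lemma hausdorff_measurement_le1 N r P Q : hausdorff_measurement N r P Q <= 1.
Proof.
have [mu Pmu] := pyramid_measurement_nonempty P N r.
have [nu Qnu] := pyramid_measurement_nonempty Q N r.
apply: hausdorff_le => x _; [exists nu => //|exists mu => //];
  exact: prokhorov_le1.
Qed.

Lemma hausdorff_measurement_fin N r P Q : hausdorff_measurement N r P Q \is a fin_num.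
Proof.
rewrite ge0_fin_numE ?hausdorff_measurement_ge0//.
by rewrite (le_lt_trans (hausdorff_measurement_le1 _ _ _ _))// ltry.
Qed.

Lemma hausdorff_measurement_mono N M r r' P Q : (N <= M)%N -> (r%:num <= r'%:num)%R ->
  hausdorff_measurement N r P Q <= hausdorff_measurement M r' P Q.
Proof.
move=> NM rr'; apply/lee_addgt0Pr => e e0.
pose h := fine (hausdorff_measurement M r' P Q).
have hE : hausdorff_measurement M r' P Q = h%:E.
  by rewrite /h fineK// hausdorff_measurement_fin.
have h0 : (0 <= h)%R by rewrite -lee_fin -hE hausdorff_measurement_ge0.
have /hausdorff_measurement_lt[PQ QP] : hausdorff_measurement M r' P Q < (h + e)%:E.
  by rewrite hE lte_fin ltrDl.
rewrite hE -EFinD; apply: hausdorff_measurement_le; first by rewrite ltr_wpDl.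
  exact: (pyramid_measurement_project NM rr' PQ).
exact: (pyramid_measurement_project NM rr' QP).
Qed.

(** The measurements of P approximate each of its elements; replaced by nearby
    measurements of Q, they give elements of Q that are box close to it. *)
Lemma pyramid_sub P Q :
  (forall N r, hausdorff_measurement N r P Q = 0) -> forall A, P A -> Q A.
Proof.
move=> PQ0 A PA; apply: pyramid_closed => e e0.
have e20 : (0 < e / 2)%R by rewrite divr_gt0.
have [N [r [mu [_ Amu [d d0 dP]]]]] := measurement_approx A e20.
have /hausdorff_measurement_lt[PQ _] : hausdorff_measurement N r P Q < d%:E.
  by rewrite PQ0 lte_fin.
have [nu [B [QB Bnu]] near] := PQ mu (ex_intro _ A (conj PA Amu)).
exists (support_class nu); split.
  exact: pyramid_downward QB (support_class_dominated Bnu).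
by apply: le_lt_trans (dP _ near) _; rewrite lte_fin; lra.
Qed.

Lemma pyramid_eq P Q : (forall A, P A <-> Q A) -> P = Q.
Proof.
case: P Q => [p p1 p2 p3 p4] [q q1 q2 q3 q4] /= pq.
have E : p = q by apply/funext => A; apply/propext.
by subst q; congr Pyramid; exact: Prop_irrelevance.
Qed.

Let coef n : R := ((n.+1%:R * 2 ^+ n.+1)^-1)%R.

Let coef_gt0 n : (0 < coef n)%R.
Proof. by rewrite invr_gt0 mulr_gt0// exprn_gt0. Qed.

Let dPi_term n P Q := (coef n)%:E * hausdorff_measurement n.+1 (posnat R n) P Q.

Let dPi_term_ge0 n P Q : 0 <= dPi_term n P Q.
Proof. by rewrite mule_ge0 ?hausdorff_measurement_ge0// lee_fin ltW. Qed.

Let dPiE P Q : dPi P Q = \sum_(n <oo) dPi_term n P Q.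
Proof. by []. Qed.

Lemma dPi_ge0 P Q : 0 <= dPi P Q.
Proof. by rewrite dPiE; apply: nneseries_ge0. Qed.

(** The n-th weight is the n-th term of a geometric series of sum 1, divided
    by n + 1; the bound may thus grow linearly. *)
Lemma dPi_le (P Q : pyramid R) e : (0 <= e)%R ->
  (forall n, hausdorff_measurement n.+1 (posnat R n) P Q <= (e * n.+1%:R)%:E) ->
  dPi P Q <= e%:E.
Proof.
move=> e0 H; rewrite dPiE; apply: le_trans (epsilon_trick0 xpredT e0).
apply: lee_nneseries => // n _; apply: (@le_trans _ _ ((coef n)%:E * (e * n.+1%:R)%:E)).
  by apply: lee_wpmul2l => //; rewrite lee_fin ltW.
rewrite -EFinM lee_fin /coef invfM natrX mulrC mulrA -(mulrA e) mulfV ?mulr1//.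
Qed.

Lemma dPi_fin P Q : dPi P Q \is a fin_num.
Proof.
rewrite ge0_fin_numE ?dPi_ge0//; apply: (@le_lt_trans _ _ 1%:E); last exact: ltry.
apply: dPi_le => // n; apply: le_trans (hausdorff_measurement_le1 _ _ _ _) _.
by rewrite mul1r lee_fin ler1n.
Qed.

Lemma dPiC P Q : dPi P Q = dPi Q P.
Proof.
rewrite !dPiE; apply: eq_eseriesr => n _; congr (_ * _).
by apply: hausdorff_sym; exact: prokhorovC.
Qed.

Lemma dPi_triangle P Q S : dPi P S <= dPi P Q + dPi Q S.
Proof.
rewrite !dPiE -nneseriesD//; apply: lee_nneseries => // n _.
rewrite /dPi_term -ge0_muleDr ?hausdorff_measurement_ge0//.
apply: lee_wpmul2l; first by rewrite lee_fin ltW.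
apply: hausdorff_triangle; [exact: prokhorov_ge0|exact: prokhorov_triangle| |];
  exact: pyramid_measurement_nonempty.
Qed.

Lemma dPixx P : dPi P P = 0.
Proof.
rewrite dPiE eseries0// => n _ _; rewrite /dPi_term /hausdorff_measurement hausdorffxx ?mule0//.
- exact: prokhorov_ge0.
- exact: prokhorovxx.
- exact: pyramid_measurement_nonempty.
Qed.

(** The cube [-r, r]^N embeds in a cube of the series as soon as the index of
    the latter exceeds N and r. *)
Lemma hausdorff_measurement_dPi N r : exists2 c : R, (0 < c)%R &
  forall P Q, c%:E * hausdorff_measurement N r P Q <= dPi P Q.
Proof.
pose n := maxn N (Num.trunc (r%:num : R)).
exists (coef n) => // P Q; apply: (@le_trans _ _ (dPi_term n P Q)).
  apply: lee_wpmul2l; first by rewrite lee_fin ltW.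
  apply: hausdorff_measurement_mono; first by rewrite leqW// leq_maxl.
  apply: ltW; apply: (lt_le_trans (truncnS_gt _)).
  by rewrite /= ler_nat ltnS leq_maxr.
by rewrite dPiE (@nneseriesD1 R _ n)// leeDl// nneseries_ge0.
Qed.

Lemma dPi_metric : is_metric (@dPi R).
Proof.
split=> [P Q|P Q|P Q|P Q S].
- by rewrite dPi_ge0 dPi_fin.
- split=> [PQ|->]; last exact: dPixx.
  have H0 N r : hausdorff_measurement N r P Q = 0.
    have [c c0 /(_ P Q)] := hausdorff_measurement_dPi N r.
    rewrite PQ pmule_rle0 ?lte_fin// => H.
    by apply/eqP; rewrite eq_le H hausdorff_measurement_ge0.
  apply: pyramid_eq => A; split; first exact: pyramid_sub.
  apply: pyramid_sub => N r; rewrite -(H0 N r).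
  by apply: hausdorff_sym; exact: prokhorovC.
- exact: dPiC.
- exact: dPi_triangle.
Qed.

End pyramid_hausdorff.

(** * Weak convergence of pyramids *)


(** Replaces the extraction of subsequences: if [Q] is not eventual, some
    ultrafilter finer than the cofinite filter contains the complement of
    [Q]. *)
Lemma near_infty_ultra (Q : set nat) :
  (forall U : set_system nat, UltraFilter U -> \oo `<=` U -> U Q) ->
  \forall n \near \oo, Q n.
Proof.
move=> UQ; apply: contrapT => nQ.
have PF : ProperFilter (within (~` Q) \oo).
  apply: Build_ProperFilter_ex => A; rewrite /within/= => HA.
  apply: contrapT => A0; apply: nQ; apply: filterS HA => n HAn.
  by apply: contrapT => nQn; apply: A0; exists n; exact: HAn.
have [U [UU sub]] := ultraFilterLemma PF.
have /filter_ex[n [Qn nQn]] : U (Q `&` ~` Q); last by [].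
apply: filterI.
  by apply: UQ => A HA; apply: sub; rewrite /within /=; apply: filterS HA => n.
by apply: sub; exact: withinT.
Qed.

Section weak_convergence.
Context (R : realType).
Implicit Types (P Q : pyramid R) (N : nat) (r : {posnum R}) (e : R).

Lemma box_ge0 (X Y : qmspace R) : 0 <= box X Y.
Proof.
apply: le_ereal_inf_tmp => _ [pi [S [_ cS ->]]]; rewrite le_max; apply/orP; left.
have mS : measurable (S : set (borel (X * Y)%type)) by exact: closed_borel.
by rewrite sube_ge0 ?probability_le1// fin_num_measure.
Qed.

Lemma box_to_ge0 (A : isoclass R) (E : isoclass R -> Prop) : 0 <= box_to A E.
Proof. by apply: le_ereal_inf_tmp => _ [B [_ ->]]; exact: box_ge0. Qed.

Lemma box_to_le (A : isoclass R) (E : isoclass R -> Prop) (B : isoclass R) c :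
  E B -> box A B <= c -> box_to A E <= c.
Proof. by move=> EB; apply: le_trans; apply: ereal_inf_lbound; exists B. Qed.

Lemma box_to_lt (A : isoclass R) (E : isoclass R -> Prop) e :
  box_to A E < e%:E -> exists2 B : isoclass R, E B & box A B < e%:E.
Proof. by move=> /ereal_inf_lt[_ [B [EB ->]] ABe]; exists B. Qed.

(** Measurements of a pyramid are elements of the pyramid. *)
Lemma pyramid_measurement_support P N r (mu : probability (borel (cube N r)) R) :
  pyramid_measurement P N r mu <-> P (support_class mu).
Proof.
split=> [[X [PX Xmu]]|Pmu].
  exact: pyramid_downward PX (support_class_dominated Xmu).
by exists (support_class mu); split => //; exact: support_class_measurement.
Qed.

Lemma measurement_box_to P (A : isoclass R) N r (mu : probability (borel (cube N r)) R) e :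
  (e <= 1)%R -> box_to A P < e%:E -> measurement A mu ->
  exists2 nu, pyramid_measurement P N r nu & near_measures e mu nu.
Proof.
move=> e1 /box_to_lt[B PB AB] Amu.
have [nu Bnu near] := measurement_box e1 AB Amu.
by exists nu => //; exists B.
Qed.

Variables (Ps : nat -> pyramid R) (P : pyramid R).

Let measurement_cvg N r := hausdorff_measurement N r (Ps n) P @[n --> \oo] --> 0.

Let measurement_cvgP N r : measurement_cvg N r <-> forall e, (0 < e)%R ->
  \forall n \near \oo, hausdorff_measurement N r (Ps n) P < e%:E.
Proof. by apply: cvge0P => n; exact: hausdorff_measurement_ge0. Qed.

(** If measurements [mu n] of P were far from those of P_n, take their limit
    along an ultrafilter and a single [mu n0] close to it.  It comes from one
    element of P, to which P_n is box close, and so is close to measurements of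
    P_n; but [mu n0] is close to [mu n]. *)
Lemma weak_limit_measurement_lower N r e : (0 < e)%R ->
  (forall A : isoclass R, P A -> box_to A (Ps n) @[n --> \oo] --> 0) ->
  \forall n \near \oo, forall mu, pyramid_measurement P N r mu ->
    exists2 nu, pyramid_measurement (Ps n) N r nu & near_measures e mu nu.
Proof.
move=> e0 cvgP; apply: near_infty_ultra => U UU ooU.
set Q := (X in U X); have [//|UnQ] := in_ultra_setVsetC Q UU.
have e30 : (0 < e / 3)%R by rewrite divr_gt0.
have /choice[mu muP] : forall n, exists mu, pyramid_measurement P N r mu /\
    (~ Q n -> forall nu, pyramid_measurement (Ps n) N r nu -> ~ near_measures e mu nu).
  move=> n; have [Qn|nQn] := pselect (Q n).
    by have [mu Pmu] := pyramid_measurement_nonempty P N r; exists mu; split.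
  move/existsNP: (nQn) => [mu /not_implyP[Pmu no]]; exists mu; split => // _ nu Qnu near.
  by apply: no; exists nu.
have [la laP] := ultra_prokhorov_limit mu UU.
have [n0 near0] := filter_ex (laP _ e30).
have [[X [PX Xmu]] _] := muP n0.
pose d := Num.min (e / 3)%R 1%R.
have d0 : (0 < d)%R by rewrite lt_min e30 ltr01.
have Xd : U [set n | box_to X (Ps n) < d%:E].
  apply: ooU; have /cvge0P H := cvgP X PX.
  by apply: H => // n; exact: box_to_ge0.
have [n [[nQn nearn] boxn]] := filter_ex (filterI (filterI UnQ (laP _ e30)) Xd).
have [|nu Qnu near] := measurement_box_to _ boxn Xmu; first by rewrite ge_min lexx orbT.
exfalso; apply: ((muP n).2 nQn nu Qnu).
have -> : e = (e / 3 + e / 3 + e / 3)%R by lra.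
apply: near_measures_trans (near_measuresW _ near); last by rewrite ge_min lexx.
by apply: near_measures_trans nearn (near_measuresC near0).
Qed.

(** If measurements [mu n] of P_n were far from those of P, let [la] be their
    limit along an ultrafilter.  The support spaces of [mu n] are in P_n and box
    converge to that of [la], which is therefore in P; then [la] is a
    measurement of P close to [mu n]. *)
Lemma weak_limit_measurement_upper N r e : (0 < e)%R ->
  (forall A : isoclass R, ~ P A -> 0 < limn_einf (fun n => box_to A (Ps n))) ->
  \forall n \near \oo, forall mu, pyramid_measurement (Ps n) N r mu ->
    exists2 nu, pyramid_measurement P N r nu & near_measures e mu nu.
Proof.
move=> e0 far; apply: near_infty_ultra => U UU ooU.
set Q := (X in U X); have [//|UnQ] := in_ultra_setVsetC Q UU.
have /choice[mu muP] : forall n, exists mu, pyramid_measurement (Ps n) N r mu /\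
    (~ Q n -> forall nu, pyramid_measurement P N r nu -> ~ near_measures e mu nu).
  move=> n; have [Qn|nQn] := pselect (Q n).
    by have [mu Pmu] := pyramid_measurement_nonempty (Ps n) N r; exists mu; split.
  move/existsNP: (nQn) => [mu /not_implyP[Pmu no]]; exists mu; split => // _ nu Qnu near.
  by apply: no; exists nu.
have [la laP] := ultra_prokhorov_limit mu UU.
have Pla : pyramid_measurement P N r la.
  apply/pyramid_measurement_support; apply: contrapT => nP.
  have /limn_einf_gt0P[c c0 cP] := far _ nP.
  have c20 : (0 < c / 2)%R by rewrite divr_gt0.
  have [d d0 dP] := box_support_class_near la c20.
  have [n [cn near]] := filter_ex (filterI (ooU _ cP) (laP _ d0)).
  have : box_to (support_class la) (Ps n) <= (c / 2)%:E.
    apply: (@box_to_le _ _ (support_class (mu n))).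
      by apply/pyramid_measurement_support; exact: (muP n).1.
    by apply: dP; exact: near_measuresC.
  by move=> /(le_trans cn); rewrite lee_fin; lra.
have [n [nQn near]] := filter_ex (filterI UnQ (laP _ e0)).
by exfalso; exact: ((muP n).2 nQn la Pla).
Qed.

Lemma weak_measurement_cvg : weakly_converges Ps P -> forall N r, measurement_cvg N r.
Proof.
move=> [near far] N r; apply/measurement_cvgP => e e0.
have e20 : (0 < e / 2)%R by rewrite divr_gt0.
have := weak_limit_measurement_lower N r e20 near.
have := weak_limit_measurement_upper N r e20 far.
apply: filterS2 => n upper lower.
apply: (@le_lt_trans _ _ (e / 2)%:E); last by rewrite lte_fin; lra.
exact: hausdorff_measurement_le.
Qed.

Lemma measurement_cvg_weak : (forall N r, (0 < N)%N -> measurement_cvg N r) ->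
  weakly_converges Ps P.
Proof.
move=> cvgM; split=> [A PA|A nPA].
  apply/cvge0P => [n|e e0]; first exact: box_to_ge0.
  have e20 : (0 < e / 2)%R by rewrite divr_gt0.
  have [N [r [mu [N0 Amu [d d0 dP]]]]] := measurement_approx A e20.
  have /measurement_cvgP/(_ _ d0) := cvgM N r N0.
  apply: filterS => n /hausdorff_measurement_lt[_ PQ].
  have [nu Qnu near] := PQ mu (ex_intro _ A (conj PA Amu)).
  apply: (@le_lt_trans _ _ (e / 2)%:E); last by rewrite lte_fin; lra.
  apply: (@box_to_le _ _ (support_class nu)); last exact: dP.
  exact/pyramid_measurement_support.
apply/limn_einf_gt0P; apply: contrapT => close; apply: nPA.
apply: pyramid_closed => e e0.
have e20 : (0 < e / 2)%R by rewrite divr_gt0.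
have [N [r [mu [N0 Amu [d d0 dP]]]]] := measurement_approx A e20.
have d20 : (0 < d / 2)%R by rewrite divr_gt0.
pose c := Num.min (d / 2)%R 1%R.
have c0 : (0 < c)%R by rewrite lt_min d20 ltr01.
have [n [boxn Hn]] : exists n, box_to A (Ps n) < c%:E /\
    hausdorff_measurement N r (Ps n) P < (d / 2)%:E.
  apply: contrapT => no; apply: close; exists c => //.
  have /measurement_cvgP/(_ _ d20) := cvgM N r N0.
  apply: filterS => n Hn; rewrite leNgt; apply/negP => boxn.
  by apply: no; exists n.
have [|nu Qnu near1] := measurement_box_to _ boxn Amu; first by rewrite ge_min lexx orbT.
have [/(_ _ Qnu)[la Pla near2] _] := hausdorff_measurement_lt Hn.
exists (support_class la); split; first exact/pyramid_measurement_support.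
apply: (@le_lt_trans _ _ (e / 2)%:E); last by rewrite lte_fin; lra.
apply: dP; have -> : d = (d / 2 + d / 2)%R by lra.
apply: near_measures_trans near2; apply: near_measuresW near1.
by rewrite ge_min lexx.
Qed.

(** The first K distances are eventually at most e / 2, and after that the
    factor 1 / (n + 1) in the weights makes distances at most 1 harmless. *)
Lemma measurement_cvg_dPi : (forall N r, (0 < N)%N -> measurement_cvg N r) ->
  dPi (Ps n) P @[n --> \oo] --> 0.
Proof.
move=> cvgM; apply/cvge0P => [n|e e0]; first exact: dPi_ge0.
have e20 : (0 < e / 2)%R by rewrite divr_gt0.
have [K _ KP] := near_infty_natSinv_lt (PosNum e20).
have : \forall n \near \oo, forall k : 'I_K,
    hausdorff_measurement k.+1 (posnat R k) (Ps n) P < (e / 2)%:E.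
  apply: filter_forall => k.
  by have /measurement_cvgP := cvgM k.+1 (posnat R k) (ltn0Sn k); exact.
apply: filterS => n Hn.
apply: (@le_lt_trans _ _ (e / 2)%:E); last by rewrite lte_fin; lra.
apply: dPi_le; first exact: ltW.
move=> k; have k1 : (1 <= k.+1%:R :> R)%R by rewrite ler1n.
have [kK|Kk] := ltnP k K.
  apply: (le_trans (ltW (Hn (Ordinal kK)))).
  by rewrite lee_fin ler_peMr// ltW.
apply: le_trans (hausdorff_measurement_le1 _ _ _ _) _.
have /= := KP k Kk; rewrite lee_fin -ler_pdivrMr// mul1r.
exact: ltW.
Qed.

Lemma dPi_measurement_cvg : dPi (Ps n) P @[n --> \oo] --> 0 ->
  forall N r, measurement_cvg N r.
Proof.
move=> /cvge0P H N r; have {}H := H (fun n => dPi_ge0 _ _).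
have [c c0 cP] := @hausdorff_measurement_dPi R N r.
apply/measurement_cvgP => e e0.
have ce0 : (0 < c * e)%R by rewrite mulr_gt0.
have := H _ ce0; apply: filterS => n /(le_lt_trans (cP _ _)).
by rewrite EFinM lte_pmul2l// lte_fin.
Qed.

End weak_convergence.

Theorem theorem4p4 (R : realType) :
  is_metric (@dPi R) /\
  forall (Ps : nat -> pyramid R) (P : pyramid R),
    let i := weakly_converges Ps P in
    let ii := forall (N : nat) (r : {posnum R}), (0 < N)%N ->
      hausdorff (@prokhorov R N r) (pyramid_measurement (Ps n) N r)
        (pyramid_measurement P N r) @[n --> \oo] --> 0 in
    let iii := dPi (Ps n) P @[n --> \oo] --> 0 in
    (i <-> ii) /\ (ii <-> iii).
Proof.
split; first exact: dPi_metric.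
move=> Ps P i ii iii; split; split.
- by move=> wc N r _; exact: weak_measurement_cvg.
- exact: measurement_cvg_weak.
- exact: measurement_cvg_dPi.
- by move=> cd N r _; exact: dPi_measurement_cvg.
Qed.
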